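(* Let $n$ be a positive integer, let $F_{n-1}$ be the free subgroup of the pure braid group $P_n$ generated by $A_{1n},A_{2n},\dots,A_{n-1,n}$, and let $g_n:F_{n-1}\to GL_n(\mathbb{Z}[t_1^{\pm1},\dots,t_n^{\pm1}])$ be the restriction to $F_{n-1}$ of the unreduced Gassner representation of $P_n$. Then $$\ker(g_n)\subseteq[\Gamma^3F_{n-1},\Gamma^2F_{n-1}].$$
   Context: $P_n$ is the pure braid group on $n$ strings with its standard generators $A_{rs}$, $1\le r<s\le n$. The unreduced Gassner representation is the homomorphism $G_n:P_n\to GL_n(\mathbb{Z}[t_1^{\pm1},\dots,t_n^{\pm1}])$ given by $$G_n(A_{rs})=\begin{pmatrix} I_{r-1}&0&0&0&0\\ 0&1-t_r+t_rt_s&0&t_r(1-t_r)&0\\ 0&\vec u&I_{s-r-1}&\vec v&0\\ 0&1-t_s&0&t_r&0\\ 0&0&0&0&I_{n-s}\end{pmatrix},$$ where $\vec u=\big((1-t_{r+1})(1-t_s),\dots,(1-t_{s-1})(1-t_s)\big)^\top$, $\vec v=\big((1-t_{r+1})(t_r-1),\dots,(1-t_{s-1})(t_r-1)\big)^\top$, and $I_k$ is the $k\times k$ identity matrix. $F_{n-1}$ is the free subgroup of $P_n$ with free generators $A_{1n},\dots,A_{n-1,n}$ (the kernel of the map $P_n\to P_{n-1}$ deleting the last string), and $g_n=G_n|_{F_{n-1}}$; thus $g_n$ is the homomorphism from the free group on $A_{1n},\dots,A_{n-1,n}$ sending $A_{rn}$ to the matrix above with $s=n$. For a group $H$, $\Gamma^\bullet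 H$ is the lower central series: $\Gamma^1H=H$, $\Gamma^{i+1}H=[\Gamma^iH,H]$. For subgroups $A,B$ of $H$, $[A,B]$ is the subgroup generated by the commutators $[a,b]$ with $a\in A$, $b\in B$. *)

(* Defs.v *)
From HB Require Import structures.
From mathcomp Require Import all_boot all_algebra.
From mathcomp Require Import ring.
From mathcomp Require Import boolp classical_sets.
From mathcomp.multinomials Require Import mpoly.

Set Implicit Arguments.
Unset Strict Implicit.
Unset Printing Implicit Defensive.

Import GRing.Theory.

Section Subgroups.
Local Open Scope group_scope.
Local Open Scope classical_set_scope.
Variable G : groupType.
Implicit Types A B H : set G.

Definition is_subgroup H :=
  [/\ H 1, (forall x y, H x -> H y -> H (x * y)) & (forall x, H x -> H x^-1)].

Definition generated A : set G := smallest is_subgroup A.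

Definition commutator_subgroup A B : set G :=
  generated [set z | exists x y, [/\ A x, B y & z = [~ x, y]]].

(* Numbered from 1, so [lower_central 1 H = H]; the value at 0 is also [H]. *)
Definition lower_central i H : set G :=
  iter i.-1 (fun K => commutator_subgroup K H) H.

End Subgroups.

Inductive gterm (X : Type) : Type :=
  | GOne | GGen of X | GMul of gterm X & gterm X | GInv of gterm X.

Arguments GOne {X}.

HB.instance Definition _ X := gen_eqMixin (gterm X).
HB.instance Definition _ X := gen_choiceMixin (gterm X).

Declare Scope gterm_scope.
Delimit Scope gterm_scope with gt.
Bind Scope gterm_scope with gterm.
Notation "x * y" := (GMul x y) : gterm_scope.
Notation "x ^-1" := (GInv x) : gterm_scope.

Section Presentation.
Variables (X : Type) (rel : gterm X -> gterm X -> Prop).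
Local Open Scope gterm_scope.

Inductive pres_eq : gterm X -> gterm X -> Prop :=
  | pres_rel u v : rel u v -> pres_eq u v
  | pres_refl u : pres_eq u u
  | pres_sym u v : pres_eq u v -> pres_eq v u
  | pres_trans u v w : pres_eq u v -> pres_eq v w -> pres_eq u w
  | pres_mul u u' v v' :
      pres_eq u u' -> pres_eq v v' -> pres_eq (u * v) (u' * v')
  | pres_inv u u' : pres_eq u u' -> pres_eq u^-1 u'^-1
  | pres_mulA u v w : pres_eq (u * (v * w)) (u * v * w)
  | pres_mul1 u : pres_eq (GOne * u) u
  | pres_mulr1 u : pres_eq (u * GOne) u
  | pres_mulV u : pres_eq (u^-1 * u) GOne
  | pres_mulrV u : pres_eq (u * u^-1) GOne.

Definition pres_eqb (u v : gterm X) : bool := `[< pres_eq u v >].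

Lemma pres_eqb_refl : reflexive pres_eqb.
Proof. by move=> u; apply/asboolP; apply: pres_refl. Qed.

Lemma pres_eqb_sym : ssrbool.symmetric pres_eqb.
Proof. by move=> u v; apply/asboolP/asboolP; apply: pres_sym. Qed.

Lemma pres_eqb_trans : transitive pres_eqb.
Proof.
move=> v u w /asboolP uv /asboolP vw; apply/asboolP; exact: pres_trans vw.
Qed.

Canonical pres_equiv :=
  EquivRel pres_eqb pres_eqb_refl pres_eqb_sym pres_eqb_trans.

Local Open Scope quotient_scope.

Definition presented : Type := {eq_quot pres_equiv}.

HB.instance Definition _ := Choice.on presented.
HB.instance Definition _ := Quotient.on presented.
HB.instance Definition _ := EqQuotient.on presented.

Definition pres_gen (x : X) : presented := \pi_presented (GGen x).

Lemma presP u v : \pi_presented u = \pi_presented v <-> pres_eq u v.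
Proof.
split; first by move=> /eqmodP/asboolP.
by move=> uv; apply/eqmodP/asboolP.
Qed.

Lemma pres_repr u : pres_eq (repr (\pi_presented u)) u.
Proof. by apply/presP; rewrite reprK. Qed.

Definition pres_op1 : presented := \pi_presented GOne.
Definition pres_opM (x y : presented) : presented :=
  \pi_presented (repr x * repr y)%gt.
Definition pres_opV (x : presented) : presented :=
  \pi_presented ((repr x)^-1)%gt.

Lemma pres_opME u v :
  pres_opM (\pi_presented u) (\pi_presented v) = \pi_presented (u * v)%gt.
Proof. by apply/presP; apply: pres_mul; apply: pres_repr. Qed.

Lemma pres_opVE u : pres_opV (\pi_presented u) = \pi_presented (u^-1)%gt.
Proof. by apply/presP; apply: pres_inv; apply: pres_repr. Qed.

Lemma pres_opA : associative pres_opM.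
Proof.
elim/quotW=> u; elim/quotW=> v; elim/quotW=> w.
by rewrite (pres_opME v w) (pres_opME u v) !pres_opME; apply/presP/pres_mulA.
Qed.

Lemma pres_op1l : left_id pres_op1 pres_opM.
Proof. by elim/quotW=> u; rewrite pres_opME; apply/presP/pres_mul1. Qed.

Lemma pres_op1r : right_id pres_op1 pres_opM.
Proof. by elim/quotW=> u; rewrite pres_opME; apply/presP/pres_mulr1. Qed.

Lemma pres_opVl : left_inverse pres_op1 pres_opV pres_opM.
Proof.
by elim/quotW=> u; rewrite pres_opVE pres_opME; apply/presP/pres_mulV.
Qed.

Lemma pres_opVr : right_inverse pres_op1 pres_opV pres_opM.
Proof.
by elim/quotW=> u; rewrite pres_opVE pres_opME; apply/presP/pres_mulrV.
Qed.

HB.instance Definition _ := isGroup.Build presented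
  pres_opA pres_op1l pres_op1r pres_opVl pres_opVr.

Section Lift.
Variables (H : groupType) (f : X -> H).
Local Open Scope group_scope.

Fixpoint gterm_eval (u : gterm X) : H :=
  match u with
  | GOne => 1
  | GGen x => f x
  | GMul u v => gterm_eval u * gterm_eval v
  | GInv u => (gterm_eval u)^-1
  end.

Definition pres_lift of (forall u v, rel u v -> gterm_eval u = gterm_eval v) :=
  fun x : presented => gterm_eval (repr x).

Hypothesis f_rel : forall u v, rel u v -> gterm_eval u = gterm_eval v.

Lemma gterm_eval_pres_eq u v : pres_eq u v -> gterm_eval u = gterm_eval v.
Proof.
elim=> {u v} //=; first by move=> u v w _ -> _ ->.
- by move=> u u' v v' _ -> _ ->.
- by move=> u u' _ ->.
- by move=> u v w; rewrite mulgA.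
- by move=> u; rewrite mul1g.
- by move=> u; rewrite mulg1.
- by move=> u; rewrite mulVg.
- by move=> u; rewrite mulgV.
Qed.

Lemma pres_lift_pi u : pres_lift f_rel (\pi_presented u) = gterm_eval u.
Proof. exact/gterm_eval_pres_eq/pres_repr. Qed.

Lemma pres_lift_gen x : pres_lift f_rel (pres_gen x) = f x.
Proof. exact: pres_lift_pi. Qed.

Lemma pres_liftF : {morph pres_lift f_rel : x y / x / y}.
Proof.
elim/quotW=> u; elim/quotW=> v.
have -> : \pi_presented u / \pi_presented v = \pi_presented (u * v^-1)%gt.
  by rewrite -pres_opME -pres_opVE.
by rewrite !pres_lift_pi.
Qed.

HB.instance Definition _ :=
  isGroupMorphism.Build presented H (pres_lift f_rel) pres_liftF.

End Lift.
End Presentation.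

Definition braid_pair n := {p : 'I_n * 'I_n | (p.1 < p.2)%N}.

Section PureBraids.
Variable n : nat.

Definition mk_braid_pair (r s : 'I_n) (rs : (r < s)%N) : braid_pair n :=
  exist (fun p : 'I_n * 'I_n => (p.1 < p.2)%N) (r, s) rs.

Local Notation T rs := (GGen (mk_braid_pair rs)).

Local Open Scope gterm_scope.

(* Artin's presentation, in the form of Birman, "Braids, links, and mapping
   class groups", Lemma 1.8.2; [A_rs] is there
   [s_(s-1) .. s_(r+1) s_r^2 s_(r+1)^-1 .. s_(s-1)^-1] in terms of the standard
   generators [s_i] of the braid group.  Strings are numbered from 0. *)
Inductive pure_braid_rel : gterm (braid_pair n) -> gterm (braid_pair n) -> Prop :=
  | pb_disjoint (r s i j : 'I_n) (rs : (r < s)%N) (ij : (i < j)%N) :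
      (s < i)%N ->
      pure_braid_rel ((T rs)^-1 * T ij * T rs) (T ij)
  | pb_nested (r s i j : 'I_n) (rs : (r < s)%N) (ij : (i < j)%N) :
      (i < r)%N -> (s < j)%N ->
      pure_braid_rel ((T rs)^-1 * T ij * T rs) (T ij)
  | pb_adjacent (r s j : 'I_n) (rs : (r < s)%N) (sj : (s < j)%N) (rj : (r < j)%N) :
      pure_braid_rel ((T rs)^-1 * T sj * T rs) (T rj * T sj * (T rj)^-1)
  | pb_common (r s j : 'I_n) (rs : (r < s)%N) (sj : (s < j)%N) (rj : (r < j)%N) :
      pure_braid_rel ((T rs)^-1 * T rj * T rs)
        (T rj * T sj * T rj * (T sj)^-1 * (T rj)^-1)
  | pb_linked (r i s j : 'I_n) (rs : (r < s)%N) (ij : (i < j)%N)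
      (rj : (r < j)%N) (sj : (s < j)%N) :
      (r < i)%N -> (i < s)%N ->
      pure_braid_rel ((T rs)^-1 * T ij * T rs)
        (T rj * T sj * (T rj)^-1 * (T sj)^-1 * T ij
           * T sj * T rj * (T sj)^-1 * (T rj)^-1).

Definition pure_braid := presented pure_braid_rel.
HB.instance Definition _ := Group.on pure_braid.

Definition pbA (r s : 'I_n) (rs : (r < s)%N) : pure_braid :=
  pres_gen pure_braid_rel (mk_braid_pair rs).

Local Open Scope classical_set_scope.

Definition last_string_subgroup : set pure_braid :=
  generated [set x | exists (r s : 'I_n) (rs : (r < s)%N),
                       s.+1 = n /\ x = pbA rs].

End PureBraids.

Section GeneralLinear.
Variables (n : nat) (R : comUnitRingType).
Local Open Scope ring_scope.

Record general_linear := GeneralLinear {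
  gl_mx :> 'M[R]_n;
  gl_mx_unit : gl_mx \in unitmx
}.

HB.instance Definition _ := [isSub for gl_mx].
HB.instance Definition _ := [Choice of general_linear by <:].

Lemma gl_mul_unit (A B : general_linear) : A *m B \in unitmx.
Proof. by rewrite unitmx_mul !gl_mx_unit. Qed.

Lemma gl_inv_unit (A : general_linear) : invmx A \in unitmx.
Proof. by rewrite unitmx_inv gl_mx_unit. Qed.

Definition gl_one := GeneralLinear (unitmx1 R n).
Definition gl_mul A B := GeneralLinear (gl_mul_unit A B).
Definition gl_inv A := GeneralLinear (gl_inv_unit A).

Lemma gl_mulA : associative gl_mul.
Proof. by move=> A B C; apply/val_inj; rewrite /= mulmxA. Qed.

Lemma gl_mul1l : left_id gl_one gl_mul.
Proof. by move=> A; apply/val_inj; rewrite /= mul1mx. Qed.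

Lemma gl_mul1r : right_id gl_one gl_mul.
Proof. by move=> A; apply/val_inj; rewrite /= mulmx1. Qed.

Lemma gl_mulVl : left_inverse gl_one gl_inv gl_mul.
Proof. by move=> A; apply/val_inj; rewrite /= mulVmx ?gl_mx_unit. Qed.

Lemma gl_mulVr : right_inverse gl_one gl_inv gl_mul.
Proof. by move=> A; apply/val_inj; rewrite /= mulmxV ?gl_mx_unit. Qed.

HB.instance Definition _ := isGroup.Build general_linear
  gl_mulA gl_mul1l gl_mul1r gl_mulVl gl_mulVr.

End GeneralLinear.


Section GassnerMatrix.
Variables (n : nat) (R : comUnitRingType) (t : 'I_n -> R).
Local Open Scope ring_scope.

(* The identity except in columns [r] and [s] of the rows from [r] to [s]. *)
Definition gassner_mx (r s : 'I_n) : 'M[R]_n :=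
  \matrix_(i, j)
    if i == r then
      if j == r then 1 - t r + t r * t s
      else if j == s then t r * (1 - t r) else 0
    else if i == s then
      if j == r then 1 - t s else if j == s then t r else 0
    else if (r < i < s)%N then
      if j == r then (1 - t i) * (1 - t s)
      else if j == s then (1 - t i) * (t r - 1) else (i == j)%:R
    else (i == j)%:R.

(* [gassner_mx r s = 1 + gcol r s * grow r s] when [r < s]. *)
Definition gcol (r s : 'I_n) : 'cV[R]_n :=
  \col_i if i == r then - t r else if i == s then 1
         else if (r < i < s)%N then 1 - t i else 0.

Definition grow (r s : 'I_n) : 'rV[R]_n :=
  \row_j ((1 - t s) * (j == r)%:R - (1 - t r) * (j == s)%:R).

Lemma gassner_mxE (r s : 'I_n) : (r < s)%N ->
  gassner_mx r s = 1%:M + gcol r s *m grow r s.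
Proof.
move=> rs; have nrs : (r == s) = false by apply/negbTE; rewrite neq_ltn rs.
have nsr : (s == r) = false by rewrite eq_sym.
apply/matrixP => i j; rewrite !mxE big_ord1 !mxE.
have sE := (nrs, nsr, @mulr1n R, @mulr0n R).
have [->{i}|nir] := eqVneq i r.
  have [->|njr] := eqVneq j r; first by rewrite ?sE; ring.
  by case: (eqVneq j s) => _; rewrite ?sE; ring.
have [{nir}->{i}|nis] := eqVneq i s.
  have [->|njr] := eqVneq j r; first by rewrite ?sE; ring.
  by case: (eqVneq j s) => _; rewrite ?sE; ring.
case: ifP => _; last by ring.
have [->|njr] := eqVneq j r; first by rewrite ?sE ?(negbTE nir) ?sE; ring.
by have [->|njs] := eqVneq j s; rewrite ?(negbTE nis) ?sE; ring.
Qed.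

Local Notation dot u v := ((u *m v) 0 0).

Lemma dot_grow (r s : 'I_n) (v : 'cV[R]_n) :
  dot (grow r s) v = (1 - t s) * v r 0 - (1 - t r) * v s 0.
Proof.
rewrite mxE; under eq_bigr => k _ do rewrite !mxE mulrBl -!mulrA.
rewrite sumrB -!mulr_sumr (bigD1 r) //= eqxx mul1r big1 => [|k /negbTE->];
  last by rewrite mul0r.
rewrite (bigD1 s) //= eqxx mul1r big1 => [|k /negbTE->]; last by rewrite mul0r.
by rewrite !addr0.
Qed.

Lemma gassner_col (r s : 'I_n) (v : 'cV[R]_n) : (r < s)%N ->
  gassner_mx r s *m v = v + dot (grow r s) v *: gcol r s.
Proof.
move=> rs; rewrite gassner_mxE // mulmxDl mul1mx -mulmxA.
by rewrite {1}[grow r s *m v]mx11_scalar mul_mx_scalar.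
Qed.

Lemma gassner_row (r s : 'I_n) (u : 'rV[R]_n) : (r < s)%N ->
  u *m gassner_mx r s = u + dot u (gcol r s) *: grow r s.
Proof.
move=> rs; rewrite gassner_mxE // mulmxDr mulmx1 mulmxA.
by rewrite {1}[u *m gcol r s]mx11_scalar mul_scalar_mx.
Qed.

Lemma gassner_colE (r s k : 'I_n) (v : 'cV[R]_n) : (r < s)%N ->
  (gassner_mx r s *m v) k 0 =
  v k 0 + ((1 - t s) * v r 0 - (1 - t r) * v s 0) * gcol r s k 0.
Proof.
by move=> rs; rewrite gassner_col // dot_grow [LHS]mxE [X in _ + X = _]mxE.
Qed.

Lemma gassner_rowE (r s k : 'I_n) (u : 'rV[R]_n) : (r < s)%N ->
  (u *m gassner_mx r s) 0 k = u 0 k + dot u (gcol r s) * grow r s 0 k.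
Proof. by move=> rs; rewrite gassner_row // [LHS]mxE [X in _ + X = _]mxE. Qed.

Lemma gassner_dotE (r s : 'I_n) (u : 'rV[R]_n) (v : 'cV[R]_n) : (r < s)%N ->
  dot (u *m gassner_mx r s) v = dot u v + dot u (gcol r s) * dot (grow r s) v.
Proof.
move=> rs; rewrite gassner_row // mulmxDl -scalemxAl.
by rewrite [LHS]mxE [X in _ + X = _]mxE.
Qed.

Lemma scale_colE a (v : 'cV[R]_n) k : (a *: v) k 0 = a * v k 0.
Proof. by rewrite mxE. Qed.

Lemma scale_rowE a (v : 'rV[R]_n) k : (a *: v) 0 k = a * v 0 k.
Proof. by rewrite mxE. Qed.

Lemma gcol_l r s : gcol r s r 0 = - t r.
Proof. by rewrite mxE eqxx. Qed.

Lemma gcol_r (r s : 'I_n) : (r < s)%N -> gcol r s s 0 = 1.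
Proof. by move=> rs; rewrite mxE eqxx -val_eqE gtn_eqF. Qed.

Lemma gcol_lt (r s i : 'I_n) : (i < r)%N -> (r < s)%N -> gcol r s i 0 = 0.
Proof.
move=> ir rs; rewrite mxE -!val_eqE /= !ltn_eqF // ?(ltn_trans ir) //.
by rewrite ltnNge ltnW.
Qed.

Lemma gcol_gt (r s i : 'I_n) : (r < s)%N -> (s < i)%N -> gcol r s i 0 = 0.
Proof.
move=> rs si; rewrite mxE -!val_eqE /= !gtn_eqF // ?(ltn_trans rs) //=.
by rewrite ltnNge ltnW.
Qed.

Lemma gcol_in (r s i : 'I_n) :
  (r < i)%N -> (i < s)%N -> gcol r s i 0 = 1 - t i.
Proof.
by move=> ri si; rewrite mxE -!val_eqE /= gtn_eqF // ltn_eqF // ri si.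
Qed.

Lemma gcolD (r s j : 'I_n) : (r < s)%N -> (s < j)%N ->
  gcol r j = gcol r s + gcol s j.
Proof.
move=> rs sj; have rj := ltn_trans rs sj.
apply/colP => k; rewrite [in RHS]mxE; have [kr|] := ltnP k r.
  by have ks := ltn_trans kr rs; rewrite !gcol_lt // addr0.
rewrite leq_eqVlt => /predU1P[/val_inj <-|rk].
  by rewrite !gcol_l gcol_lt // addr0.
have [ks|] := ltnP k s.
  by have kj := ltn_trans ks sj; rewrite (gcol_lt ks) // !gcol_in // addr0.
rewrite leq_eqVlt => /predU1P[/val_inj <-|sk].
  by rewrite gcol_l gcol_r // gcol_in.
rewrite (gcol_gt rs) // add0r; have [kj|] := ltnP k j.
  by rewrite !gcol_in.
rewrite leq_eqVlt => /predU1P[/val_inj <-|jk].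
  by rewrite !gcol_r.
by rewrite !gcol_gt.
Qed.

Lemma rank1_comm (r s : 'I_n) (N : 'M[R]_n) (a : R) : (r < s)%N ->
  N *m gcol r s = a *: gcol r s -> grow r s *m N = a *: grow r s ->
  gassner_mx r s *m N = N *m gassner_mx r s.
Proof.
move=> rs Nc wN; rewrite gassner_mxE // mulmxDl mulmxDr mul1mx mulmx1.
by rewrite mulmxA Nc -mulmxA wN -scalemxAl -scalemxAr.
Qed.

Lemma gassner_comm0 (r s i j : 'I_n) : (r < s)%N -> (i < j)%N ->
  dot (grow r s) (gcol i j) = 0 -> dot (grow i j) (gcol r s) = 0 ->
  gassner_mx i j *m gassner_mx r s = gassner_mx r s *m gassner_mx i j.
Proof.
move=> rs ij e1 e2; apply: (rank1_comm (a := 1)) => //.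
  by rewrite gassner_col // e1 scale0r addr0 scale1r.
by rewrite gassner_row // e2 scale0r addr0 scale1r.
Qed.

Lemma gassner_disjoint (r s i j : 'I_n) :
  (r < s)%N -> (i < j)%N -> (s < i)%N ->
  gassner_mx i j *m gassner_mx r s = gassner_mx r s *m gassner_mx i j.
Proof.
move=> rs ij si; have ri := ltn_trans rs si; have sj := ltn_trans si ij.
apply: gassner_comm0 => //; rewrite dot_grow.
  by rewrite !gcol_lt //; ring.
by rewrite !gcol_gt //; ring.
Qed.

Lemma gassner_nested (r s i j : 'I_n) :
  (r < s)%N -> (i < j)%N -> (i < r)%N -> (s < j)%N ->
  gassner_mx i j *m gassner_mx r s = gassner_mx r s *m gassner_mx i j.
Proof.
move=> rs ij ir sj; have is_ := ltn_trans ir rs; have rj := ltn_trans rs sj.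
apply: gassner_comm0 => //; rewrite dot_grow.
  by rewrite !gcol_in //; ring.
by rewrite gcol_lt // gcol_gt //; ring.
Qed.

Lemma gcolDE (r s j k : 'I_n) : (r < s)%N -> (s < j)%N ->
  gcol r j k 0 = gcol r s k 0 + gcol s j k 0.
Proof. by move=> rs sj; rewrite (gcolD rs sj) [LHS]mxE. Qed.

Section Triple.
Variables r s j : 'I_n.
Hypotheses (rs : (r < s)%N) (sj : (s < j)%N) (rj : (r < j)%N).

Let C := (gcol_l, gcol_r rs, gcol_r sj, gcol_r rj, gcol_lt rs sj,
  gcol_gt rs sj, gcol_in rs sj).

Lemma gassner_adjacent :
  gassner_mx s j *m (gassner_mx r s *m gassner_mx r j) =
  gassner_mx r s *m gassner_mx r j *m gassner_mx s j.
Proof.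
apply: (rank1_comm (a := t r)) => //.
  apply/colP => k; rewrite -mulmxA scale_colE !gassner_colE // !C.
  by rewrite (gcolDE k rs sj); ring.
apply/rowP => k; rewrite mulmxA scale_rowE !(gassner_rowE, gassner_dotE) //.
by rewrite !dot_grow !C !mxE; ring.
Qed.

Lemma gassner_common :
  gassner_mx r j *m (gassner_mx r s *m gassner_mx r j *m gassner_mx s j) =
  gassner_mx r s *m gassner_mx r j *m gassner_mx s j *m gassner_mx r j.
Proof.
apply: (rank1_comm (a := t r * t s * t j)) => //.
  apply/colP => k; rewrite -!mulmxA scale_colE !gassner_colE // !C.
  by rewrite (gcolDE k rs sj); ring.
apply/rowP => k; rewrite !mulmxA scale_rowE !(gassner_rowE, gassner_dotE) //.
by rewrite !dot_grow !C !mxE; ring.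
Qed.

Lemma gassner_linked_col (i : 'I_n) : (r < i)%N -> (i < s)%N ->
  gassner_mx r s *m gassner_mx r j *m gassner_mx s j *m gcol i j =
  gassner_mx s j *m gassner_mx r j *m gcol i j.
Proof.
move=> ri is_; have ij := ltn_trans is_ sj.
have E := (gcol_lt ri ij, gcol_in is_ sj, gcol_r ij).
apply/colP => k; rewrite -!mulmxA !gassner_colE // !E !C.
by rewrite (gcolDE k rs sj); ring.
Qed.

Lemma gassner_linked_row (i : 'I_n) : (r < i)%N -> (i < s)%N ->
  grow i j *m (gassner_mx r s *m gassner_mx r j *m gassner_mx s j) =
  grow i j *m (gassner_mx s j *m gassner_mx r j).
Proof.
move=> ri is_; have ij := ltn_trans is_ sj.
have E := (gcol_in ri is_, gcol_in ri ij, gcol_lt is_ sj).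
apply/rowP => k; rewrite !mulmxA !(gassner_rowE, gassner_dotE) //.
by rewrite !dot_grow !E !C !mxE; ring.
Qed.

End Triple.
Hypothesis t_unit : forall i, t i \is a GRing.unit.

Lemma gassner_mx_unit (r s : 'I_n) : (r < s)%N -> gassner_mx r s \in unitmx.
Proof.
move=> rs; pose d := (t r * t s)^-1.
have dE : d * (t r * t s) = 1 by rewrite mulVr // unitrM !t_unit.
suff /mulmx1_unit[] : gassner_mx r s *m
  (1%:M - d *: (gcol r s *m grow r s)) = 1%:M by [].
rewrite mulmxBr mulmx1 -scalemxAr mulmxA gassner_col // dot_grow.
rewrite gcol_l gcol_r // gassner_mxE // mulmxDl -scalemxAl.
move: (gcol r s *m grow r s) => P; apply/matrixP => i j.
rewrite !mxE; set e := _%:R; set x := P i j.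
transitivity (e + (1 - d * (t r * t s)) * x); first by ring.
by rewrite dE subrr mul0r addr0.
Qed.

Definition gassner_gl (p : braid_pair n) : general_linear n R :=
  GeneralLinear (gassner_mx_unit (valP p)).

Local Open Scope group_scope.

Let g (r s : 'I_n) (rs : (r < s)%N) := gassner_gl (mk_braid_pair rs).

Lemma conj_eq (G : groupType) (a x w : G) :
  a * (x * w) = x * w * a -> x^-1 * a * x = w * a * w^-1.
Proof.
move=> e; apply: (mulIg w); rewrite mulgVK; apply: (mulgI x).
by rewrite !mulgA mulgV mul1g -!mulgA e !mulgA.
Qed.

Lemma gassner_rel u v : pure_braid_rel u v ->
  gterm_eval gassner_gl u = gterm_eval gassner_gl v.
Proof.
case=> {u v} /=.
- move=> r s i j rs ij si; rewrite -/(g rs) -/(g ij).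
  rewrite -[RHS]mulg1 -[in RHS]invg1 -[X in X * 1^-1]mul1g.
  apply: conj_eq; rewrite mulg1; apply/val_inj; exact: gassner_disjoint.
- move=> r s i j rs ij ir sj; rewrite -/(g rs) -/(g ij).
  rewrite -[RHS]mulg1 -[in RHS]invg1 -[X in X * 1^-1]mul1g.
  apply: conj_eq; rewrite mulg1; apply/val_inj; exact: gassner_nested.
- move=> r s j rs sj rj; apply: conj_eq; apply/val_inj.
  exact: gassner_adjacent.
- move=> r s j rs sj rj; rewrite -/(g rs) -/(g sj) -/(g rj).
  have -> : g rj * g sj * g rj * (g sj)^-1 * (g rj)^-1 =
    (g rj * g sj) * g rj * (g rj * g sj)^-1 by rewrite invgM !mulgA.
  apply: conj_eq; rewrite [g rs * _]mulgA; apply/val_inj; exact: gassner_common.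
move=> r i s j rs ij rj sj ri is_.
rewrite -/(g rs) -/(g sj) -/(g rj) -/(g ij).
set X := g rs * g rj * g sj; set Y := g sj * g rj.
have -> : g rj * g sj * (g rj)^-1 * (g sj)^-1 * g ij
    * g sj * g rj * (g sj)^-1 * (g rj)^-1 =
  (g rj * g sj * Y^-1) * g ij * (g rj * g sj * Y^-1)^-1.
  by rewrite /Y !invgM !invgK !mulgA.
apply: conj_eq.
have -> : g rs * (g rj * g sj * Y^-1) = X * Y^-1 by rewrite /X !mulgA.
have XY : X * Y = Y * X.
  have c1 : g rj * X = X * g rj.
    by apply/val_inj; apply: gassner_common.
  have c2 : g sj * X = X * g sj.
    rewrite /X !mulgA; congr (_ * _); rewrite -mulgA.
    by apply/val_inj; apply: gassner_adjacent.
  by rewrite /Y mulgA -c2 -mulgA -c1 mulgA.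
have XYV : X * Y^-1 = Y^-1 * X.
  by apply: (mulIg Y); rewrite mulgVK -mulgA XY mulKg.
apply/val_inj; apply: (rank1_comm (a := 1%R)) => //.
  rewrite scale1r XYV -[gl_mx _]/(invmx Y *m X)%R -mulmxA.
  have -> : (X *m gcol i j = Y *m gcol i j)%R.
    exact: gassner_linked_col.
  by rewrite mulKmx // gl_mx_unit.
rewrite scale1r -[gl_mx _]/(X *m invmx Y)%R mulmxA.
have -> : (grow i j *m X = grow i j *m Y)%R by exact: gassner_linked_row.
by rewrite mulmxK // gl_mx_unit.
Qed.

End GassnerMatrix.

Section Laurent.
Variable n : nat.
Local Open Scope ring_scope.

Local Notation P := {mpoly int[n]}.
Local Notation "p %:F" := (@tofrac P p).

(* The ring of Laurent polynomials is realized inside the field of rational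
   functions, as the elements that a monomial multiplies into a polynomial. *)
Definition is_laurent : {pred {fraction P}} :=
  fun x => `[< exists (m : 'X_{1..n}) (p : P), 'X_[m]%:F * x = p%:F >].

Lemma is_laurentP x :
  reflect (exists (m : 'X_{1..n}) (p : P), 'X_[m]%:F * x = p%:F)
          (x \in is_laurent).
Proof. exact: asboolP. Qed.

Lemma laurent_subring : subring_closed is_laurent.
Proof.
split.
- by apply/is_laurentP; exists 0%MM, 1; rewrite mpolyX0 mulr1.
- move=> x y /is_laurentP[m [p xE]] /is_laurentP[k [q yE]].
  apply/is_laurentP; exists (m + k)%MM, ('X_[k] * p - 'X_[m] * q).
  by rewrite mpolyXD rmorphB !rmorphM /= -xE -yE; ring.
- move=> x y /is_laurentP[m [p xE]] /is_laurentP[k [q yE]].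
  apply/is_laurentP; exists (m + k)%MM, (p * q).
  by rewrite mpolyXD !rmorphM /= -xE -yE; ring.
Qed.

HB.instance Definition _ :=
  GRing.isSubringClosed.Build {fraction P} is_laurent laurent_subring.

Record laurent := Laurent {
  laurent_val :> {fraction P};
  laurentP : laurent_val \in is_laurent
}.

HB.instance Definition _ := [isSub for laurent_val].
HB.instance Definition _ := [Choice of laurent by <:].
HB.instance Definition _ := [SubChoice_isSubComNzRing of laurent by <:].

Definition laurent_unit : pred laurent :=
  fun x => (x != 0) && ((val x)^-1 \in is_laurent).

Definition laurent_inv (x : laurent) : laurent :=
  if laurent_unit x then insubd x (val x)^-1 else x.

Lemma laurent_mulVr : {in laurent_unit, left_inverse 1 laurent_inv *%R}.
Proof.
move=> x ux; have {}ux : laurent_unit x = true by [].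
rewrite /laurent_inv ux; case/andP: ux => x0 xV; apply/val_inj; rewrite rmorphM rmorph1 /=.
by rewrite insubdK // mulVf // -(rmorph0 val) (inj_eq val_inj).
Qed.

Lemma laurent_unitP (x y : laurent) : y * x = 1 -> laurent_unit x.
Proof.
move=> /(congr1 val); rewrite rmorphM rmorph1 /= => yx.
have x0 : laurent_val x != 0.
  by apply: contra_eq_neq yx => ->; rewrite mulr0 eq_sym oner_neq0.
rewrite /laurent_unit -(inj_eq val_inj) rmorph0 x0 /=.
by rewrite -[_^-1]mul1r -yx mulfK // laurentP.
Qed.

Lemma laurent_inv_out : {in [predC laurent_unit], laurent_inv =1 id}.
Proof. by move=> x /negbTE ux; rewrite /laurent_inv [laurent_unit x]ux. Qed.

HB.instance Definition _ := GRing.ComNzRing_hasMulInverse.Build laurent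
  laurent_mulVr laurent_unitP laurent_inv_out.

Lemma laurent_var_subproof (i : 'I_n) : ('X_i : P)%:F \in is_laurent.
Proof. by apply/is_laurentP; exists 0%MM, 'X_i; rewrite mpolyX0 mul1r. Qed.

Definition laurent_var (i : 'I_n) : laurent := Laurent (laurent_var_subproof i).

Lemma laurent_var_unit i : laurent_var i \is a GRing.unit.
Proof.
have Xi0 : ('X_i : P)%:F != 0.
  rewrite tofrac_eq0; apply/eqP => /(congr1 (mcoeff U_(i)))/eqP.
  by rewrite mcoeffX eqxx mcoeff0 oner_eq0.
apply/andP; split; first by rewrite -(inj_eq val_inj) rmorph0.
by apply/is_laurentP; exists U_(i)%MM, 1; rewrite mulfV.
Qed.

End Laurent.

Definition gassner n : pure_braid n -> general_linear n (laurent n) :=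
  pres_lift (gassner_rel (@laurent_var_unit n)).

HB.instance Definition _ n := UMagmaMorphism.on (@gassner n).

Lemma gassner_pbA n (r s : 'I_n) (rs : (r < s)%N) :
  gl_mx (gassner (pbA rs)) = gassner_mx (@laurent_var n) r s.
Proof. by rewrite /gassner pres_lift_gen. Qed.

Definition ker_gassner_last n : set (pure_braid n) :=
  [set x | last_string_subgroup x /\ gassner x = 1%g]%classic.

(* Main.v *)
Require Import Defs.
From HB Require Import structures.
From mathcomp Require Import all_boot all_algebra.
From mathcomp Require Import ring zify.
From mathcomp Require Import boolp classical_sets.
From mathcomp.multinomials Require Import ssrcomplements mpoly.

(** Let [F] be the subgroup generated by the [A_in], written [x_i] below, with
    [F' = [F, F]] and [F'' = [F', F']].  The kernel is first placed in [F'']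
    and then in [K = [G3, G2]], where [G2 = F'] and [G3 = [G2, F]].  Membership
    in a subgroup [L] of [H] with [[H, H]] inside [L] is always decided by a map
    [phi] to an abelian group that is additive on [H] and has kernel [L] there
    ([abelian_quotient]); so both steps come down to showing [phi g = 0].

    First step, [gassner_kernel_second_derived].  This is the theorem of Magnus
    that the abelianized Fox derivatives detect [F'']; they can be read off the
    last row of the Gassner matrix.  Indeed, modulo [h = 1 - t_n], the first
    [n - 1] columns of every matrix of the image of [F] are those of the
    identity; dividing the last row by [h] and then setting [t_n = 1] gives a
    map [beta] with [beta (g g') = beta g + t^g beta g'] and
    [beta x_k = e_k], which is the Fox gradient of [g].  It is the chain of
    edges, in the lattice of exponents, of the path spelled by [g].  Choose for
    each vertex [a] the element [s a = x_1 ^ a_1 x_2 ^ a_2 ...]; the edge from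
    [a] in direction [k] gets the value [phi (s a x_k (s (a + e_k))^-1)].  The
    product telescopes along a path, so [phi (s a g (s b)^-1)] is the total
    value of the chain of [g].  When the chain is zero and [a = b], this puts a
    conjugate of [g] in the kernel of [phi], that is in [F''].

    Second step, [second_derived_kernel_test].  Substitute [t_i = 1 - e u_i] and
    [t_n = 1 - e h] with integers [u_i], [h] and a parameter [e] such that
    [e ^ 5 = 0].  Then [x_i] becomes [1 + e y_i + O (e ^ 2)] with an integral
    matrix [y_i] of rank one, and commutators of group elements have the
    commutators of the leading matrices as leading matrices.  An element [g] of
    [F''] is, modulo [K], a product of powers [C_ijkl] of the elements
    [[[x_i, x_j], [x_k, x_l]]], and its matrix is
    [1 + e ^ 4 sum C_ijkl [[y_i, y_j], [y_k, y_l]]].  If [g] is in the kernel,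
    then that sum vanishes for all [u] and [h].

    It remains to see that the vanishing kills [g] modulo [K].  Let [c_ijkl] be
    [C] antisymmetrized in [(i, j)], in [(k, l)], and under the exchange of the
    two pairs.  The part linear in [h] of the entry [(p, q)] of the sum is
    [u_p sum_jk c_pjkq u_j u_k], so that [c_pjkq + c_pkjq = 0].  Together with
    the first two antisymmetries this makes [c] change sign under every
    transposition of its four indices.  But exchanging the two pairs is an even
    permutation, and [c] changes sign under it as well; hence [c = 0]
    ([pair_alternating_eq0]), and the sum of the [C_ijkl phi [[x_i, x_j],
    [x_k, x_l]]], which depends on [c] only, is zero ([sum_alt_pairs]). *)

Set Implicit Arguments.
Unset Strict Implicit.
Unset Printing Implicit Defensive.

Import GRing.Theory.

(** * Subgroups and commutator subgroups *)

Section GeneratedSubgroups.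
Local Open Scope group_scope.
Local Open Scope classical_set_scope.
Variable G : groupType.
Implicit Types A B H K F : set G.

Lemma subgroup1 H : is_subgroup H -> H 1.
Proof. by case. Qed.

Lemma subgroupM H x y : is_subgroup H -> H x -> H y -> H (x * y).
Proof. by case=> _ HM _ Hx Hy; exact: HM. Qed.

Lemma subgroupV H x : is_subgroup H -> H x -> H x^-1.
Proof. by case=> _ _ HV Hx; exact: HV. Qed.

Lemma generated_subgroup A : is_subgroup (generated A).
Proof.
split.
- by move=> M [[]].
- move=> x y Ax Ay M MA; have [[_ MM _] _] := MA.
  exact: (MM _ _ (Ax M MA) (Ay M MA)).
- by move=> x Ax M MA; have [[_ _ MV] _] := MA; exact: (MV _ (Ax M MA)).
Qed.

Lemma generated_ind A (P : G -> Prop) : P 1 ->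
    (forall x y, generated A x -> generated A y -> P x -> P y -> P (x * y)) ->
    (forall x, generated A x -> P x -> P x^-1) ->
    (forall x, A x -> P x) ->
  forall x, generated A x -> P x.
Proof.
move=> P1 PM PV PA x Ax; have [g1 gM gV] := generated_subgroup A.
suff /(_ x Ax)[] : generated A `<=` [set x | generated A x /\ P x] by [].
apply: smallest_sub => [|y Ay]; last first.
  by split; [exact: sub_gen_smallest|exact: PA].
split=> [|y z [Ay Py] [Az Pz]|y [Ay Py]]; split=> //.
- exact: gM.
- exact: PM.
- exact: gV.
- exact: PV.
Qed.

Lemma generated_sub A H : is_subgroup H -> A `<=` H -> generated A `<=` H.
Proof. by move=> Hs AH; exact: smallest_sub. Qed.

#[local] Opaque generated.

Lemma commutator_subgroupP A B : is_subgroup (commutator_subgroup A B).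
Proof. exact: generated_subgroup. Qed.

Lemma mem_commutator A B x y : A x -> B y -> commutator_subgroup A B [~ x, y].
Proof. by move=> Ax By; apply: sub_gen_smallest; exists x, y. Qed.

Lemma mem_commutatorC A B x y :
  A x -> B y -> commutator_subgroup A B [~ y, x].
Proof.
move=> Ax By; rewrite -invgR; apply: (subgroupV (commutator_subgroupP A B)).
exact: mem_commutator.
Qed.

Lemma commutator_subgroupS A B A' B' : A `<=` A' -> B `<=` B' ->
  commutator_subgroup A B `<=` commutator_subgroup A' B'.
Proof.
move=> AA BB; apply: generated_sub; first exact: commutator_subgroupP.
by move=> _ [x [y [/AA Ax /BB By ->]]]; exact: mem_commutator.
Qed.

Lemma subgroup_commg H x y : is_subgroup H -> H x -> H y -> H [~ x, y].
Proof.
case=> _ HM HV Hx Hy; rewrite commgEl conjgE.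
exact: (HM _ _ (HV _ Hx) (HM _ _ (HV _ Hy) (HM _ _ Hx Hy))).
Qed.

Lemma commutator_sub A B H : is_subgroup H -> A `<=` H -> B `<=` H ->
  commutator_subgroup A B `<=` H.
Proof.
move=> Hs AH BH; apply: generated_sub => // _ [x [y [/AH Ax /BH By ->]]].
exact: subgroup_commg.
Qed.

Definition normalized_by F H := forall x y, H x -> F y -> H (x ^ y).

Lemma commutator_normalized F A B : normalized_by F A -> normalized_by F B ->
  normalized_by F (commutator_subgroup A B).
Proof.
move=> AF BF x y + Fy; move: x.
apply: generated_ind => [|x x' _ _ IH IH'|x _ IH|].
- by rewrite conj1g; exact: (subgroup1 (commutator_subgroupP A B)).
- by rewrite conjMg; exact: (subgroupM (commutator_subgroupP A B) IH IH').
- by rewrite conjVg; exact: (subgroupV (commutator_subgroupP A B) IH).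
move=> _ [a [b [Aa Bb ->]]]; rewrite conjRg.
by apply: mem_commutator; [exact: AF|exact: BF].
Qed.

Lemma subgroup_normalized F : is_subgroup F -> normalized_by F F.
Proof.
case=> _ FM FV x y Fx Fy; rewrite conjgE.
exact: (FM _ _ (FV _ Fy) (FM _ _ Fx Fy)).
Qed.

Lemma commutator_subl F A : is_subgroup A -> normalized_by F A ->
  commutator_subgroup A F `<=` A.
Proof.
move=> As AF; apply: generated_sub => // _ [x [y [Ax Fy ->]]].
by rewrite commgEl; exact: (subgroupM As (subgroupV As Ax) (AF _ _ Ax Fy)).
Qed.

End GeneratedSubgroups.

Definition additive_on (G : groupType) (Z : zmodType) (H : set G)
    (phi : G -> Z) :=
  forall x y, H x -> H y -> phi (x * y)%g = (phi x + phi y)%R.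

(** * Detecting a subgroup by an additive map *)

Section AbelianQuotient.
Variables (G : groupType) (H K : set G).
Hypotheses (Hs : is_subgroup H) (Ks : is_subgroup K) (KH : (K `<=` H)%classic).
Hypothesis HK : forall x y, H x -> H y -> K [~ x, y]%g.

Local Open Scope group_scope.

Let H1 : H 1 := subgroup1 Hs.
Let HM x y : H x -> H y -> H (x * y) := subgroupM Hs.
Let HV x : H x -> H x^-1 := subgroupV Hs.
Let K1 : K 1 := subgroup1 Ks.
Let KM x y : K x -> K y -> K (x * y) := subgroupM Ks.
Let KV x : K x -> K x^-1 := subgroupV Ks.

(** Elements outside [H] are sent to [1], so that the quotient of [H] by [K] can
    be formed as a quotient of the whole type [G]. *)
Definition proj_sub (x : G) : G := if `[< H x >] then x else 1.

Let projH x : H (proj_sub x).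
Proof. by rewrite /proj_sub; case: asboolP. Qed.

Let projE x : H x -> proj_sub x = x.
Proof. by rewrite /proj_sub; case: asboolP. Qed.

Definition same_coset (x y : G) : bool :=
  `[< K ((proj_sub x)^-1 * proj_sub y) >].

Lemma same_coset_refl : reflexive same_coset.
Proof. by move=> x; apply/asboolP; rewrite mulVg. Qed.

Lemma same_coset_sym : ssrbool.symmetric same_coset.
Proof.
by move=> x y; apply/asboolP/asboolP => /KV; rewrite invgM invgK.
Qed.

Lemma same_coset_trans : transitive same_coset.
Proof.
move=> y x z /asboolP xy /asboolP yz; apply/asboolP.
by have := KM xy yz; rewrite mulgA mulgK.
Qed.

Canonical same_coset_equiv :=
  EquivRel same_coset same_coset_refl same_coset_sym same_coset_trans.

Local Open Scope quotient_scope.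

Definition ab_quot : Type := {eq_quot same_coset_equiv}.
HB.instance Definition _ := Choice.on ab_quot.
HB.instance Definition _ := Quotient.on ab_quot.
HB.instance Definition _ := EqQuotient.on ab_quot.

Notation pi := (\pi_ab_quot).

Lemma ab_quotP x y : H x -> H y -> pi x = pi y <-> K (x^-1 * y).
Proof.
move=> Hx Hy; split=> [/eqmodP/asboolP|xy]; first by rewrite !projE.
by apply/eqmodP/asboolP; rewrite !projE.
Qed.

Let rep (a : ab_quot) : G := proj_sub (repr a).

Let repK a : pi (rep a) = a.
Proof.
rewrite -[RHS]reprK; apply/eqmodP/asboolP; rewrite projE ?mulVg //.
exact: projH.
Qed.

Let rep_pi x : H x -> K (x^-1 * rep (pi x)).
Proof. by move=> Hx; apply/(ab_quotP Hx (projH _)); rewrite repK. Qed.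

Let Kconj x y : K x -> H y -> K (x ^ y).
Proof.
move=> Kx Hy; have := KM Kx (HK (KH Kx) Hy).
by rewrite commgEl mulVKg.
Qed.

Definition ab_add (a b : ab_quot) := pi (rep a * rep b).
Definition ab_opp (a : ab_quot) := pi (rep a)^-1.

Lemma ab_addE x y : H x -> H y -> ab_add (pi x) (pi y) = pi (x * y).
Proof.
move=> Hx Hy; have [Hx' Hy'] := (projH (repr (pi x)), projH (repr (pi y))).
apply/esym/(ab_quotP (HM Hx Hy) (HM Hx' Hy')).
have -> : (x * y)^-1 * (rep (pi x) * rep (pi y)) =
    (x^-1 * rep (pi x)) ^ y * (y^-1 * rep (pi y)).
  by rewrite invgM conjgE !mulgA mulgK.
by apply: KM; [apply: Kconj => //; exact: rep_pi|exact: rep_pi].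
Qed.

Lemma ab_oppE x : H x -> ab_opp (pi x) = pi x^-1.
Proof.
move=> Hx; have Hx' := projH (repr (pi x)).
apply/(ab_quotP (HV Hx') (HV Hx)); rewrite invgK.
have -> : rep (pi x) * x^-1 = (x^-1 * rep (pi x)) ^ x^-1.
  by rewrite conjgE invgK !mulgA mulgV mul1g.
by apply: Kconj; [exact: rep_pi|exact: HV].
Qed.

Let ab_ind (P : ab_quot -> Prop) : (forall x, H x -> P (pi x)) -> forall a, P a.
Proof. by move=> Ppi a; rewrite -[a]repK; apply/Ppi/projH. Qed.

Lemma ab_addA : associative ab_add.
Proof.
elim/ab_ind=> x Hx; elim/ab_ind=> y Hy; elim/ab_ind=> z Hz.
by rewrite !ab_addE ?mulgA //; exact: HM.
Qed.

Lemma ab_addC : commutative ab_add.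
Proof.
elim/ab_ind=> x Hx; elim/ab_ind=> y Hy; rewrite !ab_addE //.
apply/(ab_quotP (HM Hx Hy) (HM Hy Hx)).
have -> : (x * y)^-1 * (y * x) = [~ y, x].
  by rewrite commgEl conjgE invgM !mulgA.
exact: HK.
Qed.

Lemma ab_add0 : left_id (pi 1) ab_add.
Proof. by elim/ab_ind=> x Hx; rewrite ab_addE // mul1g. Qed.

Lemma ab_addN : left_inverse (pi 1) ab_opp ab_add.
Proof.
by elim/ab_ind=> x Hx; rewrite ab_oppE // ab_addE ?mulVg //; exact: HV.
Qed.

HB.instance Definition _ :=
  GRing.isZmodule.Build ab_quot ab_addA ab_addC ab_add0 ab_addN.

Lemma abelian_quotient :
  exists (Z : zmodType) (phi : G -> Z), additive_on H phi /\
    (forall x, H x -> phi x = 0%R -> K x) /\ (forall x, K x -> phi x = 0%R).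
Proof.
exists ab_quot, pi; split=> [x y Hx Hy|]; first by rewrite [RHS]ab_addE.
split=> [x Hx /esym|x Kx]; first by move/(ab_quotP H1 Hx); rewrite invg1 mul1g.
by apply/esym/(ab_quotP H1 (KH Kx)); rewrite invg1 mul1g.
Qed.

End AbelianQuotient.

(** * Sums of alternating families *)

Section Alternating.
Local Open Scope ring_scope.
Variable Z : zmodType.

(** The terms of indices [(i, j)] and [(j, i)] cancel. *)
Lemma sum_sym_alt (I : finType) (A : I -> I -> int) (z : I -> I -> Z) :
    (forall i j, A j i = A i j) -> (forall i, z i i = 0) ->
    (forall i j, z j i = - z i j) ->
  \sum_i \sum_j z i j *~ A i j = 0.
Proof.
move=> AC z0 zC; rewrite pair_bigA /=.
pose lt (p : I * I) := (enum_rank p.1 < enum_rank p.2)%N.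
pose f (p : I * I) := z p.1 p.2 *~ A p.1 p.2.
rewrite (bigID lt) /= -/f [X in _ + X](bigID (fun p => p.1 == p.2)) /=.
rewrite [X in _ + (X + _)]big1 ?add0r; last first.
  by move=> [i j] /andP[_ /eqP /= ->]; rewrite /f /= z0 mul0rz.
rewrite [X in _ + X](reindex_inj (h := fun p : I * I => (p.2, p.1))) /=;
  last by move=> [i j] [k l] /= [-> ->].
rewrite [X in _ + X](eq_big lt (fun p => - f p)).
- by rewrite sumrN subrr.
- move=> [i j]; rewrite /lt /= -leqNgt leq_eqVlt -(inj_eq enum_rank_inj).
  rewrite eq_sym [enum_rank j == _]eq_sym -val_eqE /=.
  by case: ltngtP.
- by move=> [i j] _; rewrite /f /= zC mulNrz AC.
Qed.

(** The two coefficient families differ by a symmetric one. *)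
Lemma sum_alt_lt m (A : 'I_m -> 'I_m -> int) (z : 'I_m -> 'I_m -> Z) :
    (forall i, z i i = 0) -> (forall i j, z j i = - z i j) ->
  \sum_i \sum_j z i j *~ A i j =
  \sum_i \sum_j z i j *~ (if (i < j)%N then A i j - A j i else 0).
Proof.
move=> z0 zC; apply/eqP; rewrite -subr_eq0 -sumrB.
under eq_bigr => i _ do
  [rewrite -sumrB; under eq_bigr => j _ do rewrite -mulrzBr].
apply/eqP; apply: sum_sym_alt => // i j.
by case: (ltngtP i j) => [_|_|/val_inj->]; ring.
Qed.

(** Restricting to [i < j] and [k < l] turns the coefficients into [B] without
    any division; [B] is then symmetric in the two pairs while [z] alternates in
    them.  Working with ordered pairs matters, since the group [Z] may have
    torsion. *)
Lemma sum_alt_pairs m (C : 'I_m -> 'I_m -> 'I_m -> 'I_m -> int)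
    (z : 'I_m -> 'I_m -> 'I_m -> 'I_m -> Z)
    (B := fun i j k l => C i j k l - C j i k l - C i j l k + C j i l k) :
    (forall i k l, z i i k l = 0) ->
    (forall i j k l, z j i k l = - z i j k l) ->
    (forall i j k, z i j k k = 0) ->
    (forall i j k l, z i j l k = - z i j k l) ->
    (forall i j, z i j i j = 0) ->
    (forall i j k l, z k l i j = - z i j k l) ->
    (forall i j k l, B k l i j = B i j k l) ->
  \sum_i \sum_j \sum_k \sum_l z i j k l *~ C i j k l = 0.
Proof.
move=> z1 z1C z2 z2C z3 z3C BC.
under eq_bigr => i _ do under eq_bigr => j _ do rewrite sum_alt_lt //.
rewrite pair_bigA exchange_big /=.
under eq_bigr => k _ do rewrite exchange_big /=.
under eq_bigr => k _ do under eq_bigr => l _ do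
  rewrite -(pair_bigA _ (fun i j => z i j k l *~
    (if (k < l)%N then C i j k l - C i j l k else 0)))
    sum_alt_lt // pair_bigA /=.
rewrite pair_bigA /=.
pose A (q : 'I_m * 'I_m) i j :=
  if (q.1 < q.2)%N then C i j q.1 q.2 - C i j q.2 q.1 else 0.
apply: (@sum_sym_alt _
  (fun q p : 'I_m * 'I_m =>
     if (p.1 < p.2)%N then A q p.1 p.2 - A q p.2 p.1 else 0)
  (fun q p => z p.1 p.2 q.1 q.2)) => [[k l] [i j]|[i j]|[k l] [i j]] //=.
rewrite /A /=; have := BC i j k l; rewrite /B.
by case: ifP; case: ifP => // _ _; lia.
Qed.

End Alternating.

(** * Four-index tensors alternating under exchange of pairs *)

Section PairSymmetry.
Local Open Scope ring_scope.
Variables (I : finType) (c : I -> I -> I -> I -> int).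
Hypotheses (c1 : forall i j k l, c j i k l = - c i j k l)
  (c2 : forall i j k l, c i j l k = - c i j k l)
  (c3 : forall i j k l, c k l i j = - c i j k l).

(** With the antisymmetry in the middle indices, [c] is sign-alternating under
    all permutations of the indices, and exchanging the pairs is an even one. *)
Lemma pair_alternating_eq0 : (forall i j k l, c i j k l + c i k j l = 0) ->
  forall i j k l, c i j k l = 0.
Proof.
move=> c4 i j k l; have c4' p q r s : c p q r s = - c p r q s.
  by apply/eqP; rewrite -addr_eq0 c4.
have := c3 i j k l; rewrite c4' c1 c2 c4'.
have := c4' i k j l; lia.
Qed.

(** The second difference of the quadratic form between [d p], [d p + d j],
    [d p + d k] and [d p + d j + d k] is [b j k + b k j]; adding [d p] keeps the
    coordinate [u p] nonzero at the four points. *)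
Lemma polarization (b : I -> I -> int) (p : I) :
  (forall u : I -> int, u p * \sum_j \sum_k b j k * u j * u k = 0) ->
  forall j k, b j k + b k j = 0.
Proof.
move=> b0 j k; pose d i : I -> int := fun x => (x == i)%:R.
pose f (u v : I -> int) := \sum_j \sum_k b j k * u j * v k.
have fD1 u v w : f (fun x => u x + v x) w = f u w + f v w.
  rewrite /f -big_split; apply: eq_bigr => i _ /=.
  by rewrite -big_split; apply: eq_bigr => x _ /=; ring.
have fD2 u v w : f w (fun x => u x + v x) = f w u + f w v.
  rewrite /f -big_split; apply: eq_bigr => i _ /=.
  by rewrite -big_split; apply: eq_bigr => x _ /=; ring.
have fd i x : f (d i) (d x) = b i x.
  rewrite /f (bigD1 i) //= [X in _ + X]big1 ?addr0; last first.
    move=> y yi; rewrite big1 // => ? _.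
    by rewrite /d (negbTE yi) mulr0 mul0r.
  rewrite (bigD1 x) //= big1 ?addr0; last first.
    by move=> y yi; rewrite /d (negbTE yi) mulr0.
  by rewrite /d !eqxx !mulr1.
have f0 u : u p != 0 -> f u u = 0.
  by move=> up; move/eqP: (b0 u); rewrite mulf_eq0 (negbTE up) => /eqP.
have e0 := f0 (d p); have e1 := f0 (fun x => d p x + d j x).
have e2 := f0 (fun x => d p x + d k x).
have e3 := f0 (fun x => d p x + d j x + d k x).
rewrite !fD1 !fD2 !fd in e0 e1 e2 e3.
move: e0 e1 e2 e3; rewrite /d eqxx.
case: (p == j); case: (p == k) => /=;
  by move=> /(_ isT) + /(_ isT) + /(_ isT) + /(_ isT); lia.
Qed.

End PairSymmetry.

(** * Leading terms of elements close to 1 *)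

Section LeadingTerm.
Local Open Scope ring_scope.
Variables (R : comNzRingType) (A : algType R) (e : R).
Implicit Types X Y a b : A.

(** The exponent is shifted: [lead k] is about terms of degree [k.+1]. *)
Definition lead k a X := exists d, X = 1 + e ^+ k.+1 *: (a + e *: d).

Lemma lead1 k : lead k 0 1.
Proof. by exists 0; rewrite scaler0 addr0 scaler0 addr0. Qed.

Lemma mul_near1 (c d : R) X Y :
  (1 + c *: X) * (1 + d *: Y) = 1 + (c *: X + d *: Y + (c * d) *: (X * Y)).
Proof.
rewrite mulrDl mul1r mulrDr mulr1 -scalerAl -scalerAr scalerA -!addrA.
by congr (_ + _); rewrite addrCA.
Qed.

Lemma leadM k a b X Y : lead k a X -> lead k b Y -> lead k (a + b) (X * Y).
Proof.
move=> [d ->] [c ->]; rewrite mul_near1.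
set p := a + e *: _; set q := b + e *: _.
exists (d + c + e ^+ k *: (p * q)).
have -> : a + b + e *: (d + c + e ^+ k *: (p * q)) =
    p + q + e ^+ k.+1 *: (p * q).
  rewrite [in LHS]scalerDr scalerA -exprS addrA; congr (_ + _).
  by rewrite scalerDr /p /q addrACA.
by rewrite [in RHS]scalerDr scalerA [in RHS]scalerDr.
Qed.

Lemma leadV k a X Y : lead k a X -> Y * X = 1 -> lead k (- a) Y.
Proof.
move=> [d ->]; set p := a + e *: _ => YX; have pE : p = a + e *: d by [].
clearbody p.
have YE : Y = 1 - e ^+ k.+1 *: (Y * p).
  by rewrite -YX mulrDr mulr1 -scalerAr addrK.
exists (- d + e ^+ k *: (Y * p * p)).
have -> : - a + e *: (- d + e ^+ k *: (Y * p * p)) =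
    - p + e ^+ k.+1 *: (Y * p * p).
  by rewrite [in LHS]scalerDr scalerA -exprS addrA scalerN -opprD -pE.
rewrite {1}YE; congr (_ + _); rewrite -scalerN; congr (_ *: _).
by rewrite {1}YE mulrBl mul1r -scalerAl opprB addrC.
Qed.

(** The commutator minus 1 is [X' Y' (XY - YX)], where [XY - YX] is the ring
    commutator of [X - 1] and [Y - 1], and [X' Y'] is 1 modulo [e]. *)
Lemma lead_comm k l a b X Y X' Y' : lead k a X -> lead l b Y ->
    X' * X = 1 -> Y' * Y = 1 ->
  lead (k + l).+1 (a * b - b * a) (X' * (Y' * (X * Y))).
Proof.
move=> kX lY XX YY; have [d' X'E] := leadV kX XX; have [c' Y'E] := leadV lY YY.
have -> : X' * (Y' * (X * Y)) = 1 + X' * Y' * (X * Y - Y * X).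
  by rewrite mulrBr -!mulrA (mulrA Y' Y X) YY mul1r XX addrCA subrr addr0.
have [w ->] : exists w, X' * Y' = 1 + e *: w.
  rewrite X'E Y'E mul_near1 ![e ^+ _.+1]exprS -mulrA -!(scalerA e) -!scalerDr.
  by eexists.
move: kX lY => [d ->] [c ->]; set p := a + e *: _; set q := b + e *: _.
rewrite !mul_near1 [(e ^+ l.+1 * _)]mulrC -exprD addSn addnS.
set E := e ^+ _.+2.
have -> : forall u v : A,
    1 + (u + v + E *: (p * q)) - (1 + (v + u + E *: (q * p))) =
    E *: (p * q - q * p).
  move=> u v; rewrite [v + u]addrC scalerBr opprD addrACA subrr add0r.
  by rewrite opprD addrACA subrr add0r.
have [v ->] : exists v, p * q - q * p = a * b - b * a + e *: v.
  exists (a * c + d * q - (b * d + c * p)).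
  have pE : p = a + e *: d by []. have qE : q = b + e *: c by [].
  clearbody p q; have -> : p * q = a * b + e *: (a * c + d * q).
    by rewrite {1}pE mulrDl {1}qE mulrDr -scalerAr -scalerAl -addrA -scalerDr.
  have -> : q * p = b * a + e *: (b * d + c * p).
    by rewrite {1}qE mulrDl {1}pE mulrDr -scalerAr -scalerAl -addrA -scalerDr.
  by rewrite opprD addrACA -scalerBr.
exists (v + w * (a * b - b * a + e *: v)).
rewrite -scalerAr mulrDl mul1r -scalerAl; congr (_ + _ *: _).
by rewrite [in RHS]scalerDr addrA.
Qed.

End LeadingTerm.

(** * Commutators under additive maps *)

Section AdditiveOn.
Local Open Scope group_scope.
Variables (G : groupType) (Z : zmodType) (H : set G) (phi : G -> Z).
Hypotheses (Hs : is_subgroup H) (phiD : additive_on H phi).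

Lemma additive_on1 : phi 1 = 0%R.
Proof.
have := phiD (subgroup1 Hs) (subgroup1 Hs); rewrite mulg1.
by move/eqP; rewrite -subr_eq subrr => /eqP.
Qed.

Lemma additive_onV x : H x -> phi x^-1 = (- phi x)%R.
Proof.
move=> Hx; apply/eqP; rewrite -addr_eq0 -phiD ?mulVg ?additive_on1 //.
exact: (subgroupV Hs).
Qed.

End AdditiveOn.

(** When triple commutators are killed by [phi], the commutator becomes a
    biadditive pairing, because [[x x', y] = [x, y] [[x, y], x'] [x', y]]. *)
Section CommutatorPairing.
Local Open Scope group_scope.
Local Open Scope classical_set_scope.
Variables (G : groupType) (Z : zmodType) (H M N : set G) (phi : G -> Z).
Hypotheses (Hs : is_subgroup H) (Ms : is_subgroup M) (phiD : additive_on M phi).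
Hypotheses (NM : N `<=` M) (phiN : forall x, N x -> phi x = 0%R).
Hypotheses (HM : forall x y, H x -> H y -> M [~ x, y])
  (HN : forall x y z, H x -> H y -> H z -> N [~ [~ x, y], z]).

Lemma pairingC x y : H x -> H y -> phi [~ y, x] = (- phi [~ x, y])%R.
Proof.
by move=> Hx Hy; rewrite -invgR; apply: (additive_onV Ms phiD); exact: HM.
Qed.

Lemma pairing_additive y : H y -> additive_on H (fun x => phi [~ x, y]).
Proof.
move=> Hy x x' Hx Hx'.
have -> : [~ x * x', y] = [~ x, y] * [~ [~ x, y], x'] * [~ x', y].
  rewrite [X in _ * X * _]commgEl mulVKg [_ ^ x']conjgE -!mulgA.
  by rewrite ![ [~ _, y]]commgEl !conjgE invgM -!mulgA !mulVKg.
have Mc := HM Hx Hy; have Nc := HN Hx Hy Hx'.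
rewrite (phiD (subgroupM Ms Mc (NM Nc)) (HM Hx' Hy)) (phiD Mc (NM Nc)).
by rewrite (phiN Nc) addr0.
Qed.

Lemma pairing_additiver y : H y -> additive_on H (fun x => phi [~ y, x]).
Proof.
move=> Hy x x' Hx Hx'; have Hxx := subgroupM Hs Hx Hx'.
by rewrite ![phi [~ y, _]]pairingC // pairing_additive // opprD.
Qed.

End CommutatorPairing.

(** * Coordinates of group elements and their leading terms *)

Section LeadingCoordinates.
Local Open Scope classical_set_scope.
Variables (G : groupType) (J : Type) (R : J -> comNzRingType)
  (A : forall j, algType (R j)) (e : forall j, R j) (rho : forall j, G -> A j).
Hypotheses (rho1 : forall j, rho j 1%g = 1%R)
  (rhoM : forall j x y, rho j (x * y)%g = (rho j x * rho j y)%R).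

Local Open Scope ring_scope.

Definition test_maps := forall Z : zmodType, set (G -> Z).

(** The same integers [a] express the value at [g] of every map in [T] and, in
    every representation [rho j], the leading term of the matrix of [g].  This
    is how information passes from the matrices to the group. *)
Definition has_lead (T : test_maps) (I : finType) (xi : I -> G)
    (ups : forall j, I -> A j) k g :=
  exists a : I -> int,
    (forall (Z : zmodType) (phi : G -> Z), T Z phi ->
       phi g = \sum_i phi (xi i) *~ a i) /\
    (forall j, lead (e j) k (\sum_i ups j i *~ a i) (rho j g)).

Lemma has_lead_generated (T : test_maps) (I : finType) xi ups k S :
    (forall Z phi, T Z phi -> additive_on (generated S) phi) ->
    (forall g, S g -> @has_lead T I xi ups k g) ->
  forall g, generated S g -> has_lead T xi ups k g.
Proof.
move=> TD TS; apply: generated_ind => [|x y Sx Sy|x Sx|]; last exact: TS.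
- exists (fun=> 0); split=> [Z phi /TD phiD|j].
    rewrite (additive_on1 (generated_subgroup _) phiD).
    by rewrite big1 // => i _; rewrite mulr0z.
  rewrite rho1 big1 => [|i _]; last by rewrite mulr0z.
  exact: lead1.
- move=> [a [aphi arho]] [b [bphi brho]]; exists (fun i => a i + b i).
  split=> [Z phi Tphi|j].
    rewrite (TD _ _ Tphi) // aphi // bphi // -big_split.
    by apply: eq_bigr => i _; rewrite mulrzDr.
  rewrite rhoM; under eq_bigr => i _ do rewrite mulrzDr.
  by rewrite big_split; exact: (leadM (arho j) (brho j)).
- move=> [a [aphi arho]]; exists (fun i => - a i); split=> [Z phi Tphi|j].
    rewrite (additive_onV (generated_subgroup _) (TD _ _ Tphi)) // aphi //.
    rewrite -sumrN.
    by apply: eq_bigr => i _; rewrite mulrNz.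
  under eq_bigr => i _ do rewrite mulrNz.
  by rewrite sumrN; apply: (leadV (arho j)); rewrite -rhoM mulVg rho1.
Qed.

Definition ring_comm (B : pzRingType) (a b : B) := a * b - b * a.

(** Coordinates of a commutator are products of coordinates, since both the
    values of [V] and the leading terms are bilinear in the two entries. *)
Lemma has_lead_commg (T U V : test_maps) (I I' : finType)
    xi ups xi' ups' k l g h :
    (forall Z phi, V Z phi -> T Z (fun x => phi [~ x, h]%g)) ->
    (forall Z phi i, V Z phi -> U Z (fun x => phi [~ xi i, x]%g)) ->
    @has_lead T I xi ups k g -> @has_lead U I' xi' ups' l h ->
  has_lead V (fun p : I * I' => [~ xi p.1, xi' p.2]%g)
    (fun j p => ring_comm (ups j p.1) (ups' j p.2)) (k + l).+1 [~ g, h]%g.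
Proof.
move=> VT VU [a [aphi arho]] [b [bphi brho]].
exists (fun p => a p.1 * b p.2); split=> [Z phi Vphi|j].
  rewrite (aphi _ _ (VT _ _ Vphi)).
  under eq_bigr => i _ do rewrite (bphi _ _ (VU _ _ i Vphi)) mulrz_suml.
  rewrite pair_bigA; apply: eq_bigr => p _ /=.
  by rewrite -mulrzA mulrC.
have := lead_comm (arho j) (brho j); rewrite commgEl conjgE !rhoM.
move=> /(_ (rho j g^-1%g) (rho j h^-1%g)); rewrite -!rhoM !mulVg rho1.
move=> /(_ erefl erefl).
congr (lead _ _ _ _); rewrite mulr_suml mulr_sumr.
under eq_bigr => i _ do rewrite mulr_sumr.
under [X in _ - X]eq_bigr => i _ do rewrite mulr_suml.
rewrite -sumrB; under eq_bigr => i _ do rewrite -sumrB.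
rewrite pair_bigA; apply: eq_bigr => p _ /=.
by rewrite /ring_comm !(mulrzAr, mulrzAl) -!mulrzA [b _ * _]mulrC -mulrzBl.
Qed.

End LeadingCoordinates.

(** * Specialization of Laurent polynomials *)

Section Specialization.
Local Open Scope ring_scope.
Variables (n : nat) (R : comUnitRingType) (t : 'I_n -> R).
Hypothesis t_unit : forall i, t i \is a GRing.unit.

Local Notation P := {mpoly int[n]}.
Local Notation "p %:F" := (@tofrac P p).

Definition poly_spec : P -> R := mmap intr t.
HB.instance Definition _ := GRing.RMorphism.on poly_spec.

Lemma poly_specXU i : poly_spec 'X_i = t i.
Proof. by rewrite /poly_spec mmapX mmap1U. Qed.

Lemma poly_specX_unit m : poly_spec 'X_[m] \is a GRing.unit.
Proof.
rewrite /poly_spec mmapX /mmap1.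
by elim/big_ind: _ => [|x y ux uy|i _]; rewrite ?unitr1 ?unitrX ?unitrM ?ux.
Qed.

Lemma laurent_spec_subproof (x : laurent n) :
  exists r : R, forall m p, 'X_[m]%:F * laurent_val x = p%:F ->
    r * poly_spec 'X_[m] = poly_spec p.
Proof.
have /is_laurentP[k [q kq]] := laurentP x.
exists (poly_spec q / poly_spec 'X_[k]) => m p mp.
apply: (mulIr (poly_specX_unit k)); rewrite mulrAC mulrVK ?poly_specX_unit //.
rewrite -!rmorphM /=; congr poly_spec.
apply/eqP; rewrite -tofrac_eq !rmorphM /=.
by rewrite -kq -mp; apply/eqP; ring.
Qed.

(** The ring morphism from Laurent polynomials sending the variables to the
    units [t]. *)
Definition laurent_spec (x : laurent n) : R :=
  sval (cid (laurent_spec_subproof x)).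

Lemma laurent_specP x m p : 'X_[m]%:F * laurent_val x = p%:F ->
  laurent_spec x * poly_spec 'X_[m] = poly_spec p.
Proof. by rewrite /laurent_spec; case: cid => r /= /(_ m p). Qed.

Lemma laurent_spec_is_zmod_morphism : zmod_morphism laurent_spec.
Proof.
move=> x y; have /is_laurentP[m [p xE]] := laurentP x.
have /is_laurentP[k [q yE]] := laurentP y.
apply: (mulIr (poly_specX_unit (m + k))).
rewrite (@laurent_specP _ _ ('X_[k] * p - 'X_[m] * q)); last first.
  rewrite mpolyXD [laurent_val _](rmorphB val) [in RHS]rmorphB !rmorphM /=.
  by rewrite -xE -yE; ring.
rewrite rmorphB mpolyXD !rmorphM /= -(laurent_specP xE) -(laurent_specP yE).
by ring.
Qed.

Lemma laurent_spec_is_monoid_morphism : monoid_morphism laurent_spec.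
Proof.
split=> [|x y].
  have := @laurent_specP 1 0%MM 1; rewrite mpolyX0 !rmorph1 !mulr1; exact.
have /is_laurentP[m [p xE]] := laurentP x.
have /is_laurentP[k [q yE]] := laurentP y.
apply: (mulIr (poly_specX_unit (m + k))).
rewrite (@laurent_specP _ _ (p * q)); last first.
  by rewrite mpolyXD [laurent_val _](rmorphM val) !rmorphM /= -xE -yE; ring.
rewrite mpolyXD !rmorphM /= -(laurent_specP xE) -(laurent_specP yE).
by ring.
Qed.

HB.instance Definition _ := GRing.isZmodMorphism.Build _ _ laurent_spec
  laurent_spec_is_zmod_morphism.
HB.instance Definition _ := GRing.isMonoidMorphism.Build _ _ laurent_spec
  laurent_spec_is_monoid_morphism.

Lemma laurent_spec_var i : laurent_spec (laurent_var i) = t i.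
Proof.
have := @laurent_specP (laurent_var i) 0%MM 'X_i.
by rewrite mpolyX0 !rmorph1 mulr1 mul1r poly_specXU; exact.
Qed.

Definition gassner_spec : pure_braid n -> general_linear n R :=
  pres_lift (gassner_rel t_unit).
HB.instance Definition _ := UMagmaMorphism.on gassner_spec.

Lemma gassner_spec_pbA (r s : 'I_n) (rs : (r < s)%N) :
  gl_mx (gassner_spec (pbA rs)) = gassner_mx t r s.
Proof. by rewrite /gassner_spec pres_lift_gen. Qed.

Lemma map_gassner_mx r s :
  map_mx laurent_spec (gassner_mx (@laurent_var n) r s) = gassner_mx t r s.
Proof.
apply/matrixP => i j; rewrite !mxE; do !(case: ifP => _);
by do ?rewrite (rmorph0, rmorphD, rmorphN, rmorphM, rmorph1, rmorph_nat) /=;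
   rewrite ?laurent_spec_var.
Qed.

Lemma map_gassner (g : pure_braid n) :
  map_mx laurent_spec (gassner g) = gassner_spec g.
Proof.
elim/quotW: g => u; rewrite /gassner /gassner_spec !pres_lift_pi.
elim: u => [|p|u IHu v IHv|u IHu] /=.
- by rewrite map_mx1.
- exact: map_gassner_mx.
- by rewrite map_mxM IHu IHv.
set A := gterm_eval _ u in IHu *; set B := gterm_eval _ u in IHu *.
have AV : invmx A *m A = 1%:M by rewrite mulVmx // gl_mx_unit.
rewrite -[RHS]mul1mx -(map_mx1 laurent_spec) -AV map_mxM IHu.
by rewrite mulmxK // gl_mx_unit.
Qed.

Lemma gassner_spec1 (g : pure_braid n) :
  gassner g = 1%g -> gassner_spec g = 1%g.
Proof.
by move=> g1; apply/val_inj; rewrite /= -map_gassner g1 map_mx1.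
Qed.

End Specialization.

(** * The leading matrices of the generators *)

Section SymbolMatrices.
Local Open Scope ring_scope.
Variables (m : nat).
Local Notation w i := (widen_ord (leqnSn m) i).

Lemma widen_neq_max (i : 'I_m) : (w i == ord_max :> 'I_m.+1) = false.
Proof. by rewrite -val_eqE /= ltn_eqF. Qed.

Lemma max_neq_widen (i : 'I_m) : (ord_max == w i :> 'I_m.+1) = false.
Proof. by rewrite eq_sym widen_neq_max. Qed.

Lemma widen_eq (i j : 'I_m) : (w i == w j :> 'I_m.+1) = (i == j).
Proof. by rewrite -val_eqE. Qed.

Let E := (widen_neq_max, max_neq_widen, widen_eq, eqxx,
  @mulr1n int, @mulr0n int).

(** A generator has matrix [1 + gcol *m grow]; under [t_i = 1 - e v_i] the
    column has constant term [symbol_col] and the row is [e] times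
    [symbol_row]. *)
Definition symbol_col (i : 'I_m) : 'cV[int]_m.+1 :=
  \col_a ((a == ord_max)%:R - (a == w i)%:R).

Definition symbol_row (v : 'I_m.+1 -> int) (i : 'I_m) : 'rV[int]_m.+1 :=
  \row_b (v ord_max * (b == w i)%:R - v (w i) * (b == ord_max)%:R).

Definition symbol (v : 'I_m.+1 -> int) (i : 'I_m) : 'M[int]_m.+1 :=
  symbol_col i *m symbol_row v i.

Lemma symbolE v i a b : symbol v i a b =
  ((a == ord_max)%:R - (a == w i)%:R) *
  (v ord_max * (b == w i)%:R - v (w i) * (b == ord_max)%:R).
Proof. by rewrite mxE big_ord1 !mxE. Qed.

Section Entries.
Variable v : 'I_m.+1 -> int.
Local Notation h := (v ord_max).
Local Notation u i := (v (w i)).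
Local Notation M i j := (ring_comm (symbol v i) (symbol v j)).

Lemma sum_delta (f : 'I_m -> int) (i : 'I_m) :
  \sum_k f k * (k == i)%:R = f i.
Proof.
rewrite (bigD1 i) //= eqxx mulr1 big1 ?addr0 // => k /negbTE->.
by rewrite mulr0.
Qed.

Lemma symbol_commE i j a b : M i j a b =
  u j * (((a == ord_max)%:R - (a == w j)%:R) *
    (h * (b == w i)%:R - u i * (b == ord_max)%:R)) -
  u i * (((a == ord_max)%:R - (a == w i)%:R) *
    (h * (b == w j)%:R - u j * (b == ord_max)%:R)).
Proof.
rewrite /ring_comm !mxE !big_ord_recr /=.
have S (k l : 'I_m) : \sum_(c < m) symbol v k a (w c) * symbol v l (w c) b =
   - symbol v k a (w l) * (h * (b == w l)%:R - u l * (b == ord_max)%:R).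
  rewrite -(sum_delta (fun c => - symbol v k a (w c) *
    (h * (b == w l)%:R - u l * (b == ord_max)%:R)) l).
  apply: eq_bigr => c _; rewrite [symbol v l _ _]symbolE !E; ring.
rewrite !S !symbolE !E; have [->|_] := eqVneq i j; first by ring.
by rewrite !mulr0n; ring.
Qed.

(** In the product of two commutators, the intermediate indices [r] other than
    the last contribute the part quadratic in [h], and the last index gives the
    part linear in [h], which is the one that detects [C]. *)
Lemma symbol_comm2E i j k l p q (D := fun a b : 'I_m => (a == b)%:R : int) :
  ring_comm (M i j) (M k l) (w p) (w q) =
  h ^+ 2 * \sum_r ((u i * D i p * D j r - u j * D j p * D i r) *
                   (u k * D k r * D l q - u l * D l r * D k q) -
                   (u k * D k p * D l r - u l * D l p * D k r) *
                   (u i * D i r * D j q - u j * D j r * D i q)) +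
  h * (u i * u j * (D i p - D j p) * (u k * D l q - u l * D k q) -
       u k * u l * (D k p - D l p) * (u i * D j q - u j * D i q)).
Proof.
rewrite /ring_comm [LHS]mxE [X in _ + X]mxE ![in LHS]mxE !big_ord_recr /=.
rewrite opprD addrACA mulr_sumr; congr (_ + _); last first.
  rewrite !symbol_commE !E /D ![(p == _)]eq_sym ![(q == _)]eq_sym; ring.
rewrite -sumrB; apply: eq_bigr => r _; rewrite !symbol_commE !E /D.
rewrite ![(p == _)]eq_sym ![(q == _)]eq_sym ![(r == _)]eq_sym; ring.
Qed.

End Entries.

Section Vanishing.
Variable C : 'I_m -> 'I_m -> 'I_m -> 'I_m -> int.
Hypothesis C0 : forall v, \sum_i \sum_j \sum_k \sum_l
  ring_comm (ring_comm (symbol v i) (symbol v j))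
    (ring_comm (symbol v k) (symbol v l)) *~ C i j k l = 0.

Let B i j k l := C i j k l - C j i k l - C i j l k + C j i l k.

Lemma sum_contract_row (A : 'I_m -> 'I_m -> int) (u : 'I_m -> int) p :
  \sum_i \sum_j A i j * (u i * u j * ((i == p)%:R - (j == p)%:R)) =
  u p * \sum_j (A p j - A j p) * u j.
Proof.
transitivity (\sum_i \sum_j (A i j * u i * u j * (i == p)%:R -
                             A i j * u i * u j * (j == p)%:R)).
  by apply: eq_bigr => i _; apply: eq_bigr => j _; ring.
under eq_bigr => i _ do rewrite sumrB sum_delta -mulr_suml.
rewrite sumrB sum_delta -sumrB mulr_sumr.
by apply: eq_bigr => i _; ring.
Qed.

Lemma sum_contract_col (A : 'I_m -> 'I_m -> int) (u : 'I_m -> int) q :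
  \sum_k \sum_l A k l * (u k * (l == q)%:R - u l * (k == q)%:R) =
  \sum_k (A k q - A q k) * u k.
Proof.
transitivity (\sum_k \sum_l (A k l * u k * (l == q)%:R -
                             A k l * u l * (k == q)%:R)).
  by apply: eq_bigr => k _; apply: eq_bigr => l _; ring.
under eq_bigr => k _ do rewrite sumrB sum_delta -mulr_suml.
rewrite sumrB sum_delta -sumrB.
by apply: eq_bigr => i _; ring.
Qed.

Let c i j k l := B i j k l - B k l i j.

(** This is the coefficient of [h] in the entry [(p, q)] of the vanishing sum.
    It is isolated by comparing the values at [h = 1] and [h = -1]. *)
Lemma quadratic_form_eq0 p q (u : 'I_m -> int) :
  u p * \sum_j \sum_k c p j k q * u j * u k = 0.
Proof.
pose D (a b : 'I_m) : int := (a == b)%:R.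
pose a i j k l := \sum_r
  ((u i * D i p * D j r - u j * D j p * D i r) *
   (u k * D k r * D l q - u l * D l r * D k q) -
   (u k * D k p * D l r - u l * D l p * D k r) *
   (u i * D i r * D j q - u j * D j r * D i q)).
pose b1 i j k l := C i j k l * (u k * (l == q)%:R - u l * (k == q)%:R) *
   (u i * u j * ((i == p)%:R - (j == p)%:R)).
pose b2 i j k l := C i j k l * (u k * u l * ((k == p)%:R - (l == p)%:R)) *
   (u i * (j == q)%:R - u j * (i == q)%:R).
pose S (f : 'I_m -> 'I_m -> 'I_m -> 'I_m -> int) : int :=
  \sum_i \sum_j \sum_k \sum_l f i j k l.
have SD f g : S (fun i j k l => f i j k l + g i j k l) = S f + S g.
  by rewrite /S; do 4 (rewrite -big_split; apply: eq_bigr => ? _).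
have SM x f : S (fun i j k l => x * f i j k l) = x * S f.
  by rewrite /S; do 4 (rewrite mulr_sumr; apply: eq_bigr => ? _).
have h0 h : h ^+ 2 * S (fun i j k l => C i j k l * a i j k l) +
    h * S (fun i j k l => b1 i j k l - b2 i j k l) = 0.
  (* the parameters [u] on the first [m] indices and [h] on the last one *)
  pose v (x : 'I_m.+1) := if insub (x : nat) is Some i then u i else h.
  have vw i : v (w i) = u i by rewrite /v /= valK.
  have vm : v ord_max = h by rewrite /v insubF //= ltnn.
  rewrite -!SM -SD.
  have := congr1 (fun M : 'M[int]_m.+1 => M (w p) (w q)) (C0 v).
  rewrite [X in _ = X]mxE => <-; rewrite /S summxE; apply: eq_bigr => i _.
  rewrite summxE; apply: eq_bigr => j _; rewrite summxE; apply: eq_bigr => k _.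
  rewrite summxE; apply: eq_bigr => l _; rewrite -scaler_int mxE symbol_comm2E.
  by rewrite !vw vm intz /a /b1 /b2 /D; ring.
have {h0} : S (fun i j k l => b1 i j k l - b2 i j k l) = 0.
  have := h0 1; have := h0 (-1); lia.
have -> : S (fun i j k l => b1 i j k l - b2 i j k l) = S b1 - S b2.
  by rewrite /S; do 4 (rewrite -sumrB; apply: eq_bigr => ? _).
have -> : S b1 = \sum_i \sum_j (\sum_k (C i j k q - C i j q k) * u k) *
    (u i * u j * ((i == p)%:R - (j == p)%:R)).
  apply: eq_bigr => i _; apply: eq_bigr => j _.
  rewrite -sum_contract_col mulr_suml.
  by apply: eq_bigr => k _; rewrite mulr_suml.
have -> : S b2 = \sum_i \sum_j (u p * \sum_k (C i j p k - C i j k p) * u k) *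
    (u i * (j == q)%:R - u j * (i == q)%:R).
  apply: eq_bigr => i _; apply: eq_bigr => j _.
  rewrite -sum_contract_row mulr_suml.
  by apply: eq_bigr => k _; rewrite mulr_suml.
rewrite sum_contract_row sum_contract_col => e0; rewrite -[RHS]e0.
(* [c] is symmetrized by [u j * u k], so its second half may be transposed *)
have -> : \sum_j \sum_k c p j k q * u j * u k =
    \sum_j \sum_k (B p j k q - B j q p k) * u j * u k.
  under eq_bigr => j _ do
    [under eq_bigr => k _ do rewrite !mulrBl; rewrite sumrB].
  under [RHS]eq_bigr => j _ do
    [under eq_bigr => k _ do rewrite !mulrBl; rewrite sumrB].
  rewrite !sumrB [X in _ - X]exchange_big; congr (_ - _).
  by apply: eq_bigr => j _; apply: eq_bigr => k _; ring.
rewrite mulr_sumr [in LHS]mulr_sumr -sumrB; apply: eq_bigr => j _; apply/esym.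
rewrite -mulrBr -mulrA -mulrBr; congr (_ * _).
rewrite -mulrBl -!sumrB mulr_suml; apply: eq_bigr => k _.
by rewrite /B; ring.
Qed.

Lemma pair_antisymmetrization_eq0 i j k l : B k l i j = B i j k l.
Proof.
suff /eqP : c i j k l = 0 by rewrite /c subr_eq0 => /eqP.
apply: pair_alternating_eq0 => {i j k l} i j k l; try by rewrite /c /B; ring.
apply: (@polarization _ (fun j k => c i j k l) i) => u.
exact: quadratic_form_eq0.
Qed.

End Vanishing.

End SymbolMatrices.

(** * Reductions of the representation with a nilpotent parameter *)

Section NilpotentParameter.
Local Open Scope ring_scope.

Lemma unit_sub_nilpotent (R : comUnitRingType) (e a : R) :
  e ^+ 5 = 0 -> 1 - e * a \is a GRing.unit.
Proof.
move=> e5; apply/unitrPr.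
exists (1 + e * a + (e * a) ^+ 2 + (e * a) ^+ 3 + (e * a) ^+ 4).
by transitivity (1 - e ^+ 5 * a ^+ 5); [ring|rewrite e5 mul0r subr0].
Qed.

(** Taking [e = k.+2] in the integers modulo [k.+2 ^ 5] gives [e ^ 5 = 0], which
    is exactly what keeps a term of degree 4; letting [k] vary determines that
    term as an integer. *)
Definition modulus k := (k.+2 ^ 5)%N.

Lemma modulus_gt1 k : (1 < modulus k)%N.
Proof. by rewrite /modulus (leq_trans _ (leq_pexp2l _ (isT : 1 <= 5)%N)). Qed.

Definition small k : 'Z_(modulus k) := k.+2%:R.

Lemma small5 k : small k ^+ 5 = 0.
Proof. by rewrite /small -natrX pchar_Zp ?modulus_gt1. Qed.

Lemma small4_eq0 k (z : int) : small k ^+ 4 * z%:~R = 0 -> (k.+2 %| `|z|)%N.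
Proof.
move=> z0; have : small k ^+ 4 * `|z|%:R = 0.
  case: z z0 => n //; rewrite NegzE mulrNz mulrN => /eqP.
  by rewrite oppr_eq0 => /eqP.
rewrite /small -natrX -natrM => /(congr1 val) /=.
rewrite val_Zp_nat ?modulus_gt1 // => /eqP; rewrite -/(dvdn _ _).
by rewrite /modulus expnSr dvdn_pmul2l // expn_gt0.
Qed.

End NilpotentParameter.

Section ReducedRepresentations.
Local Open Scope ring_scope.
Local Open Scope classical_set_scope.
Variable m : nat.
Local Notation w i := (widen_ord (leqnSn m) i).

Lemma widen_lt_max (i : 'I_m) : (w i < (ord_max : 'I_m.+1))%N.
Proof. by rewrite /= ltn_ord. Qed.

Definition last_gen (i : 'I_m) : pure_braid m.+1 := pbA (widen_lt_max i).

Local Notation F := (@last_string_subgroup m.+1).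

Lemma last_string_generated : F = generated (range last_gen).
Proof.
congr generated; apply/seteqP; split=> [_ [r [s [rs [sm ->]]]]|_ [i _ <-]].
  have sE : s = ord_max by apply/val_inj; case: sm.
  subst s; exists (Ordinal (rs : (r < m)%N)) => //; rewrite /last_gen.
  by congr pres_gen; apply/val_inj => /=; congr (_, _); apply/val_inj.
by exists (w i), ord_max, (widen_lt_max i).
Qed.

(** A reduction fixes the modulus and the integers [v i] of the substitution
    [t_i = 1 - e v_i]. *)
Definition reduction := (nat * ('I_m.+1 -> int))%type.
Definition red_ring (j : reduction) : comUnitRingType := 'Z_(modulus j.1).
Definition red_param (j : reduction) (i : 'I_m.+1) : red_ring j :=
  1 - small j.1 * (j.2 i)%:~R.

Lemma red_param_unit j i : red_param j i \is a GRing.unit.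
Proof. exact: unit_sub_nilpotent (small5 j.1). Qed.

Definition red_rep (j : reduction) (g : pure_braid m.+1) :
    'M[red_ring j]_m.+1 :=
  gl_mx (gassner_spec (red_param_unit j) g).

Lemma red_rep1 j : red_rep j 1%g = 1.
Proof. by rewrite /red_rep gmulf1. Qed.

Lemma red_repM j g h : red_rep j (g * h)%g = red_rep j g * red_rep j h.
Proof. by rewrite /red_rep gmulfM. Qed.

Definition red_symbol (j : reduction) (i : 'I_m) : 'M[red_ring j]_m.+1 :=
  map_mx intr (symbol j.2 i).

Lemma red_rep_gen j i :
  lead (small j.1 : red_ring j) 0 (red_symbol j i) (red_rep j (last_gen i)).
Proof.
rewrite /red_rep /last_gen gassner_spec_pbA (gassner_mxE _ (widen_lt_max i)).
set e : red_ring j := small j.1.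
(* the part of [gcol] divisible by [e] *)
pose c : 'cV[red_ring j]_m.+1 := \col_a
  if a == w i then (j.2 (w i))%:~R else if a == ord_max then 0
  else if (w i < a < (ord_max : 'I_m.+1))%N then (j.2 a)%:~R else 0.
have -> : gcol (red_param j) (w i) ord_max =
    map_mx intr (symbol_col i) + e *: c.
  apply/colP => a; rewrite !mxE rmorphB !rmorph_nat /= /red_param -/e.
  have [->|nai] := eqVneq a (w i).
    by rewrite widen_neq_max sub0r opprB addrC.
  case: (a == ord_max); first by rewrite subr0 mulr0 addr0.
  by rewrite subrr add0r; case: ifP => _; rewrite ?mulr0 // opprB addrC subrK.
have -> : grow (red_param j) (w i) ord_max =
    e *: map_mx intr (symbol_row j.2 i).
  apply/rowP => b; rewrite !mxE rmorphB !rmorphM !rmorph_nat /= /red_param -/e.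
  by rewrite !opprB ![1 + _]addrC !subrK mulrBr !mulrA.
exists (c *m map_mx intr (symbol_row j.2 i)).
rewrite expr1 -scalemxAr mulmxDl -scalemxAl -map_mxM; congr (_ + _).
Qed.

End ReducedRepresentations.

(** * The subgroups of the lower central series and their pairings *)

Section CommutatorChain.
Local Open Scope group_scope.
Local Open Scope classical_set_scope.
Variables (G : groupType) (F : set G).
Hypothesis Fs : is_subgroup F.

Local Notation G2 := (commutator_subgroup F F).
Local Notation G3 := (commutator_subgroup G2 F).

Lemma lower2_sub : G2 `<=` F.
Proof. exact: commutator_sub. Qed.

Lemma lower2_normalized : normalized_by F G2.
Proof. by apply: commutator_normalized; exact: subgroup_normalized. Qed.

Lemma lower3_sub : G3 `<=` G2.
Proof.
exact: (commutator_subl (commutator_subgroupP F F) lower2_normalized).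
Qed.

Lemma second_derived_sub : commutator_subgroup G2 G2 `<=` G3.
Proof. by apply: commutator_subgroupS => //; exact: lower2_sub. Qed.

Lemma lower32_sub : commutator_subgroup G3 G2 `<=` commutator_subgroup G2 G2.
Proof. by apply: commutator_subgroupS => //; exact: lower3_sub. Qed.

(** Elements of [F''] belong both to [G3] and to [G2]. *)
Lemma second_derived_commg x y :
    commutator_subgroup G2 G2 x -> commutator_subgroup G2 G2 y ->
  commutator_subgroup G3 G2 [~ x, y].
Proof.
move=> /second_derived_sub G3x /second_derived_sub/lower3_sub G2y.
exact: mem_commutator.
Qed.

(** The maps whose restriction to [G2] factors through [G2 / G3]. *)
Definition lower2_test : test_maps G := fun Z phi =>
  additive_on G2 phi /\ forall x, G3 x -> phi x = 0%R.

(** The maps whose restriction to [F''] factors through the quotient by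
    [[G3, G2]], on which the commutator of two elements of [G2] depends only on
    their classes modulo [G3]. *)
Definition second_derived_test : test_maps G := fun Z phi =>
  additive_on (commutator_subgroup G2 G2) phi /\
  forall x, commutator_subgroup G3 G2 x -> phi x = 0%R.

Section Lower2Pairing.
Variables (Z : zmodType) (phi : G -> Z).
Hypothesis phiT : lower2_test phi.

Let HM x y : F x -> F y -> G2 [~ x, y].
Proof. exact: mem_commutator. Qed.

Let HN x y z : F x -> F y -> F z -> G3 [~ [~ x, y], z].
Proof. by move=> Fx Fy Fz; apply: mem_commutator => //; exact: HM. Qed.

Lemma lower2_pairing y : F y -> additive_on F (fun x => phi [~ x, y]).
Proof.
move=> Fy; exact: (pairing_additive (commutator_subgroupP F F) (proj1 phiT)
  lower3_sub (proj2 phiT) HM HN Fy).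
Qed.

Lemma lower2_pairingr y : F y -> additive_on F (fun x => phi [~ y, x]).
Proof.
move=> Fy; exact: (pairing_additiver Fs (commutator_subgroupP F F)
  (proj1 phiT) lower3_sub (proj2 phiT) HM HN Fy).
Qed.

End Lower2Pairing.

Section SecondDerivedPairing.
Variables (Z : zmodType) (phi : G -> Z).
Hypothesis phiT : second_derived_test phi.

Let HM x y : G2 x -> G2 y -> commutator_subgroup G2 G2 [~ x, y].
Proof. exact: mem_commutator. Qed.

Let HN x y z :
  G2 x -> G2 y -> G2 z -> commutator_subgroup G3 G2 [~ [~ x, y], z].
Proof.
move=> Gx Gy Gz; apply: mem_commutator => //.
by apply: second_derived_sub; exact: HM.
Qed.

Lemma second_derived_pairingC x y :
  G2 x -> G2 y -> phi [~ y, x] = (- phi [~ x, y])%R.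
Proof.
exact: (pairingC (commutator_subgroupP G2 G2) (proj1 phiT) HM).
Qed.

Lemma second_derived_pairing y :
  G2 y -> lower2_test (fun x => phi [~ x, y]).
Proof.
move=> Gy; split=> [|x Gx].
  exact: (pairing_additive (commutator_subgroupP G2 G2) (proj1 phiT)
    lower32_sub (proj2 phiT) HM HN Gy).
by apply: (proj2 phiT); exact: mem_commutator.
Qed.

Lemma second_derived_pairingr y :
  G2 y -> lower2_test (fun x => phi [~ y, x]).
Proof.
move=> Gy; split=> [|x Gx].
  exact: (pairing_additiver (commutator_subgroupP F F)
    (commutator_subgroupP G2 G2) (proj1 phiT) lower32_sub (proj2 phiT)
    HM HN Gy).
by apply: (proj2 phiT); exact: mem_commutatorC.
Qed.

End SecondDerivedPairing.
End CommutatorChain.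

Lemma map_ring_comm (R : comUnitRingType) n (A B : 'M[int]_n.+1) :
  (map_mx intr (ring_comm A B) =
   ring_comm (map_mx intr A) (map_mx intr B) :> 'M[R]_n.+1)%R.
Proof. by rewrite /ring_comm map_mxB -!mulmxE !map_mxM. Qed.

Lemma sum_quadruple (T : zmodType) (I : finType) (f : (I * I) * (I * I) -> T) :
  (\sum_q f q = \sum_i \sum_j \sum_k \sum_l f ((i, j), (k, l)))%R.
Proof.
under [RHS]eq_bigr => i _ do under eq_bigr => j _ do rewrite pair_bigA.
by rewrite !pair_bigA; apply: eq_bigr => [[[i j] [k l]]].
Qed.

(** * Elements of the kernel in the second derived subgroup *)

Section SecondDerivedKernel.
Local Open Scope ring_scope.
Local Open Scope classical_set_scope.
Variable m : nat.
Local Notation F := (@last_string_subgroup m.+1).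
Local Notation G2 := (commutator_subgroup F F).
Local Notation x_ := (@last_gen m).

Lemma last_string_is_subgroup : is_subgroup F.
Proof. exact: generated_subgroup. Qed.

Lemma last_gen_in i : F (x_ i).
Proof. by rewrite last_string_generated; apply: sub_gen_smallest; exists i. Qed.

Let red_e (j : reduction m) : red_ring j := small j.1.

Lemma last_string_lead g : F g ->
  has_lead red_e (@red_rep m) (fun Z phi => additive_on F phi)
    x_ (@red_symbol m) 0 g.
Proof.
rewrite last_string_generated; apply: has_lead_generated => //.
- exact: red_rep1.
- exact: red_repM.
move=> _ [i _ <-]; exists (fun k => (k == i)%:R); split=> [Z phi _|j].
  rewrite (bigD1 i) //= eqxx big1 ?addr0 // => k /negbTE->.
  by rewrite mulr0z.
rewrite (bigD1 i) //= eqxx big1 ?addr0 => [|k /negbTE->].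
  exact: red_rep_gen.
by rewrite mulr0z.
Qed.

Lemma lower2_lead g : G2 g ->
  has_lead red_e (@red_rep m) (@lower2_test _ F)
    (fun p => [~ x_ p.1, x_ p.2]%g)
    (fun j p => ring_comm (red_symbol j p.1) (red_symbol j p.2)) 1 g.
Proof.
apply: has_lead_generated;
  [exact: red_rep1|exact: red_repM|by move=> Z phi []|].
move=> _ [x [y [Fx Fy ->]]].
have Fs := last_string_is_subgroup.
apply: (has_lead_commg (@red_rep1 m) (@red_repM m) _ _
  (last_string_lead Fx) (last_string_lead Fy)).
  by move=> Z phi phiT; exact: (lower2_pairing Fs phiT Fy).
by move=> Z phi i phiT; exact: (lower2_pairingr Fs phiT (last_gen_in i)).
Qed.

Lemma second_derived_lead g : commutator_subgroup G2 G2 g ->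
  has_lead red_e (@red_rep m) (@second_derived_test _ F)
    (fun q => [~ [~ x_ q.1.1, x_ q.1.2], [~ x_ q.2.1, x_ q.2.2]]%g)
    (fun j q => ring_comm
      (ring_comm (red_symbol j q.1.1) (red_symbol j q.1.2))
      (ring_comm (red_symbol j q.2.1) (red_symbol j q.2.2))) 3 g.
Proof.
apply: has_lead_generated;
  [exact: red_rep1|exact: red_repM|by move=> Z phi []|].
move=> _ [x [y [Gx Gy ->]]].
have Fs := last_string_is_subgroup.
apply: (has_lead_commg (@red_rep1 m) (@red_repM m) _ _
  (lower2_lead Gx) (lower2_lead Gy)).
  by move=> Z phi phiT; exact: (second_derived_pairing Fs phiT Gy).
move=> Z phi p phiT; apply: (second_derived_pairingr Fs phiT).
by apply: mem_commutator; exact: last_gen_in.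
Qed.

(** For [g] in the kernel the leading sum vanishes over the integers: an entry
    that is a multiple of every [k.+2] is zero.  So the coordinates of [g],
    antisymmetrized within each pair, are symmetric under the exchange of the
    pairs, and [phi g] is their sum against an alternating family. *)
Lemma second_derived_kernel_test g : commutator_subgroup G2 G2 g ->
    gassner g = 1%g ->
  forall (Z : zmodType) (phi : pure_braid m.+1 -> Z),
    second_derived_test F phi -> phi g = 0.
Proof.
move=> /second_derived_lead[a [aphi arho]] g1 Z phi phiT.
rewrite (aphi _ _ phiT).
pose C i j k l := a ((i, j), (k, l)).
have C0 v : \sum_i \sum_j \sum_k \sum_l
    ring_comm (ring_comm (symbol v i) (symbol v j))
      (ring_comm (symbol v k) (symbol v l)) *~ C i j k l = 0.
  set M := LHS; apply/matrixP => r s; rewrite [RHS]mxE; apply/eqP.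
  rewrite -absz_eq0 -[_ == _]negbK -lt0n; apply/negP => M0.
  (* [k.+2] exceeds the absolute value of the entry and divides it *)
  pose k := `|M r s|%N; pose j : reduction m := (k, v).
  have [d] := arho j.
  rewrite /red_rep (gassner_spec1 _ g1) /= sum_quadruple => dE.
  pose y := red_symbol j.
  have ME : \sum_i1 \sum_i2 \sum_i3 \sum_i4
      ring_comm (ring_comm (y i1) (y i2)) (ring_comm (y i3) (y i4))
        *~ a (i1, i2, (i3, i4)) = map_mx intr M.
    rewrite /M; do 4 (rewrite raddf_sum; apply: eq_bigr => ? _).
    by rewrite raddfMz /= !map_ring_comm.
  rewrite {}ME in dE.
  have {dE} : red_e j ^+ 4 *: (map_mx intr M + red_e j *: d) = 0.
    by apply: (addrI (1 : 'M_m.+1)); rewrite addr0 -dE.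
  move=> /matrixP/(_ r s); rewrite !mxE mulrDr mulrA -exprSr /red_e small5.
  rewrite mul0r addr0 => /small4_eq0 /=; rewrite -/k => /(dvdn_leq M0).
  by rewrite ltnNge leqnSn.
rewrite sum_quadruple.
have Gx i j : G2 [~ x_ i, x_ j]%g by apply: mem_commutator; exact: last_gen_in.
have phi1 := additive_on1 (commutator_subgroupP G2 G2) (proj1 phiT).
have Fs := last_string_is_subgroup; have G2s := commutator_subgroupP F F.
apply: (@sum_alt_pairs _ _ C
  (fun i j k l => phi [~ [~ x_ i, x_ j], [~ x_ k, x_ l]]%g)).
- by move=> i k l; rewrite commgg comm1g.
- move=> i j k l; rewrite -[ [~ x_ j, x_ i]%g]invgR.
  have [phiD _] := second_derived_pairing Fs phiT (Gx k l).
  exact: (additive_onV G2s phiD (Gx i j)).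
- by move=> i j k; rewrite commgg commg1.
- move=> i j k l; rewrite -[ [~ x_ l, _]%g]invgR.
  have [phiD _] := second_derived_pairingr Fs phiT (Gx i j).
  exact: (additive_onV G2s phiD (Gx k l)).
- by move=> i j; rewrite commgg.
- by move=> i j k l; exact: (second_derived_pairingC phiT).
- exact: pair_antisymmetrization_eq0.
Qed.

End SecondDerivedKernel.

(** * Fox derivatives and the second derived subgroup *)

Section FoxChain.
Local Open Scope ring_scope.
Local Open Scope classical_set_scope.
Variable m : nat.
Local Notation w i := (widen_ord (leqnSn m) i).
Local Notation F := (@last_string_subgroup m.+1).
Local Notation G2 := (commutator_subgroup F F).
Local Notation x_ := (@last_gen m).
Local Notation P := {mpoly int[m]}.
Local Notation "p %:F" := (@tofrac P p).
Local Notation last := (ord_max : 'I_m.+1).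

(** The specialization [t_n = 1], with values in the field of fractions so that
    the remaining variables are units. *)
Definition fox_param (i : 'I_m.+1) : {fraction P} :=
  if insub (i : nat) is Some j then ('X_j)%:F else 1.

Lemma fox_param_widen i : fox_param (w i) = ('X_i)%:F.
Proof. by rewrite /fox_param /= valK. Qed.

Lemma fox_param_last : fox_param last = 1.
Proof. by rewrite /fox_param insubF //= ltnn. Qed.

Lemma mpolyX_frac_neq0 (a : 'X_{1..m}) : ('X_[a])%:F != 0.
Proof.
rewrite tofrac_eq0; apply/eqP => /(congr1 (mcoeff a))/eqP.
by rewrite mcoeffX eqxx mcoeff0 oner_eq0.
Qed.

Lemma fox_param_unit i : fox_param i \is a GRing.unit.
Proof.
rewrite unitfE /fox_param; case: insub => [j|]; last exact: oner_neq0.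
exact: mpolyX_frac_neq0.
Qed.

Local Notation pi := (laurent_spec fox_param_unit).
Let h : laurent m.+1 := 1 - laurent_var last.

Lemma pi_h : pi h = 0.
Proof.
by rewrite /h rmorphB rmorph1 /= laurent_spec_var fox_param_last subrr.
Qed.

Lemma gassner_mx_widenE (R : comUnitRingType) (t : 'I_m.+1 -> R) r a k :
  gassner_mx t (w r) last a (w k) = (a == w k)%:R +
    (1 - t last) * (gcol t (w r) last a 0 * (k == r)%:R).
Proof.
rewrite (gassner_mxE _ (widen_lt_max r)) !mxE big_ord1 !mxE.
by rewrite widen_neq_max widen_eq mulr0n; ring.
Qed.

Lemma gassner_mx_corner (R : comUnitRingType) (t : 'I_m.+1 -> R) r :
  gassner_mx t (w r) last last last = t (w r).
Proof. by rewrite mxE max_neq_widen eqxx. Qed.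

(** Vertices of the lattice are taken in its positive orthant, as exponents of
    monomials; every path is translated there. *)
Definition lift_elt (a : 'X_{1..m}) : pure_braid m.+1 :=
  (\prod_(i < m) x_ i ^+ a i)%g.

Lemma last_gen_exp_in i k : F (x_ i ^+ k)%g.
Proof.
have Fs := last_string_is_subgroup m.
elim: k => [|k IH]; first by rewrite expg0; exact: (subgroup1 Fs).
by rewrite expgS; exact: (subgroupM Fs (last_gen_in i) IH).
Qed.

Lemma last_gen_prod_in (r : seq 'I_m) (a : 'X_{1..m}) :
  F (\prod_(i <- r) x_ i ^+ a i)%g.
Proof.
have Fs := last_string_is_subgroup m.
elim/big_ind: _ => [|x y Fx Fy|i _]; last exact: last_gen_exp_in.
  exact: (subgroup1 Fs).
exact: (subgroupM Fs).
Qed.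

Lemma lift_elt_in a : F (lift_elt a).
Proof. exact: last_gen_prod_in. Qed.

Lemma additive_lift_elt (Z : zmodType) (psi : pure_braid m.+1 -> Z) a :
  additive_on F psi -> psi (lift_elt a) = \sum_(i < m) psi (x_ i) *+ a i.
Proof.
move=> psiD; have Fs := last_string_is_subgroup m; rewrite /lift_elt.
have FX := last_gen_exp_in.
have psiX i k : psi (x_ i ^+ k)%g = psi (x_ i) *+ k.
  elim: k => [|k IH]; first by rewrite expg0 (additive_on1 Fs psiD).
  by rewrite expgS (psiD _ _ (last_gen_in i) (FX i k)) IH mulrS.
elim: (index_enum _) => [|i r IH].
  by rewrite !big_nil (additive_on1 Fs psiD).
by rewrite !big_cons (psiD _ _ (FX i _) (last_gen_prod_in r a)) IH psiX.
Qed.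

(** The element has exponent sum zero in every generator, hence is killed by a
    map to an abelian group with kernel [G2]. *)
Lemma edge_in_lower2 a k :
  G2 (lift_elt a * x_ k * (lift_elt (a + U_(k))%MM)^-1)%g.
Proof.
have Fs := last_string_is_subgroup m.
have FF2 x y : F x -> F y -> G2 [~ x, y]%g by exact: mem_commutator.
have [Z [psi [psiD [psi0 _]]]] :=
  abelian_quotient Fs (commutator_subgroupP F F) (lower2_sub Fs) FF2.
have Fa := lift_elt_in a; have Fk := last_gen_in k.
have Fak := lift_elt_in (a + U_(k)); have Faxk := subgroupM Fs Fa Fk.
apply: psi0; first exact: (subgroupM Fs Faxk (subgroupV Fs Fak)).
rewrite (psiD _ _ Faxk (subgroupV Fs Fak)) (psiD _ _ Fa Fk).
rewrite (additive_onV Fs psiD Fak) !additive_lift_elt //.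
under [X in _ - X]eq_bigr => i _ do rewrite mnmDE mulrnDr.
rewrite big_split [X in _ - (_ + X)](bigD1 k) //= mnmE eqxx mulr1n.
rewrite [X in _ - (_ + (_ + X))]big1 ?addr0 ?subrr // => i ik.
by rewrite mnmE eq_sym (negbTE ik).
Qed.

Section Potential.
Variables (Z : zmodType) (phi : pure_braid m.+1 -> Z).
Hypothesis phiD : additive_on G2 phi.

Definition edge_value k (a : 'X_{1..m}) : Z :=
  phi (lift_elt a * x_ k * (lift_elt (a + U_(k))%MM)^-1)%g.

(** A polynomial records a chain of edges of direction [k]: the coefficient of
    ['X_[a]] is the multiplicity of the edge starting at [a]. *)
Definition chain_value k (p : P) : Z :=
  \sum_(a <- msupp p) edge_value k a *~ p@_a.

Lemma chain_valueE k (p : P) d : (msize p <= d)%N ->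
  chain_value k p = \sum_(a : 'X_{1..m < d}) edge_value k a *~ p@_a.
Proof.
pose I := 'X_{1..m < d} : subFinType _.
move=> pd; rewrite /chain_value (big_mksub I) ?msupp_uniq //=; first last.
  by move=> a /msize_mdeg_lt /leq_trans; apply.
by rewrite big_rmcond //= => a /memN_msupp_eq0->; rewrite mulr0z.
Qed.

Lemma chain_valueB k : zmod_morphism (chain_value k).
Proof.
move=> p q; pose d := maxn (msize (p - q)) (maxn (msize p) (msize q)).
rewrite !(@chain_valueE _ _ d) /d ?leq_max ?leqnn ?orbT // -sumrB.
by apply: eq_bigr => a _; rewrite mcoeffB mulrzBr.
Qed.

HB.instance Definition _ k :=
  GRing.isZmodMorphism.Build P Z (chain_value k) (@chain_valueB k).

Lemma chain_valueX k a : chain_value k 'X_[a] = edge_value k a.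
Proof. by rewrite /chain_value msuppX big_seq1 mcoeffX eqxx mulr1z. Qed.

Lemma chain_value0 k : chain_value k 0 = 0.
Proof. exact: raddf0. Qed.

(** If [g] leads from the vertex [a] to the vertex [b], this is a loop, which is
    why it then lies in [G2]. *)
Definition transport (a b : 'X_{1..m}) (g : pure_braid m.+1) :
    pure_braid m.+1 :=
  (lift_elt a * g * (lift_elt b)^-1)%g.

Lemma transportM a b c g g' :
  transport a c (g * g')%g = (transport a b g * transport b c g')%g.
Proof. by rewrite /transport !mulgA mulgVK. Qed.

Lemma transportV a b g : transport b a g^-1%g = (transport a b g)^-1%g.
Proof. by rewrite /transport !invgM invgK !mulgA. Qed.

(** [gam last] is the last row divided by [h], so [pi (gam last k)] is the
    [k]-th Fox derivative of [g].  The path spelled by [g] leads from [q] to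
    [p]; after translation by a large enough monomial its chain has polynomial
    coefficients, and the quantification over [c] allows further translation,
    as needed to put two paths end to end.  The last clause is the telescoping
    of [phi] along the path. *)
Definition fox_chain (g : pure_braid m.+1) :=
  exists (gam : 'I_m.+1 -> 'I_m -> laurent m.+1) (p q : 'X_{1..m}),
  [/\ forall a k, gl_mx (gassner g) a (w k) = (a == w k)%:R + h * gam a k,
      pi (gl_mx (gassner g) last last) * ('X_[q])%:F = ('X_[p])%:F
    & forall c, exists D : 'I_m -> P,
      [/\ forall k, (D k)%:F = ('X_[c + q])%:F * pi (gam last k),
          G2 (transport (c + q)%MM (c + p)%MM g)
        & phi (transport (c + q)%MM (c + p)%MM g) =
          \sum_k chain_value k (D k)]].

Let G2s : is_subgroup G2 := commutator_subgroupP F F.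

Lemma pi_last_row g k gam :
    gl_mx (gassner g) last (w k) = (last == w k)%:R + h * gam ->
  pi (gl_mx (gassner g) last (w k)) = 0.
Proof.
by move=> ->; rewrite max_neq_widen add0r rmorphM /= pi_h mul0r.
Qed.

Lemma fox_chain1 : fox_chain 1%g.
Proof.
exists (fun _ _ => 0), 0%MM, 0%MM; rewrite gmulf1 /=; split=> [a k||c].
- by rewrite mxE /= mulr0 addr0.
- by rewrite mxE eqxx rmorph1 mul1r.
exists (fun=> 0); rewrite addm0 /transport mulg1 mulgV.
split=> [k||]; first by rewrite /= !rmorph0 mulr0.
- exact: (subgroup1 G2s).
rewrite (additive_on1 G2s phiD) big1 // => k _; exact: chain_value0.
Qed.

Lemma fox_chain_gen r : fox_chain (x_ r).
Proof.
exists (fun a k => gcol (@laurent_var m.+1) (w r) last a 0 * (k == r)%:R),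
  U_(r)%MM, 0%MM.
rewrite /last_gen gassner_pbA.
split=> [a k||c].
- exact: gassner_mx_widenE.
- rewrite gassner_mx_corner laurent_spec_var fox_param_widen mpolyX0.
  by rewrite tofrac1 mulr1.
exists (fun k => if k == r then 'X_[c] else 0); rewrite addm0; split=> [k||].
- rewrite gcol_r ?widen_lt_max // mul1r; case: eqP => _.
    by rewrite rmorph1 mulr1.
  by rewrite !rmorph0 mulr0.
- exact: edge_in_lower2.
rewrite (bigD1 r) //= eqxx big1 ?addr0 => [|k /negbTE->].
  by rewrite chain_valueX.
exact: chain_value0.
Qed.

(** Only the last entry of the last row of [g] survives at [t_n = 1], which
    gives the product rule of Fox derivatives.  The first path is translated by
    [c + q'] and the second by [c + p], so that the first ends where the second
    begins. *)
Lemma fox_chainM g g' : fox_chain g -> fox_chain g' -> fox_chain (g * g')%g.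
Proof.
move=> [gam [p [q [ge gt gD]]]] [gam' [p' [q' [ge' gt' gD']]]].
exists (fun a k => gam a k + \sum_b gl_mx (gassner g) a b * gam' b k),
  (p + p')%MM, (q + q')%MM.
have pi_row b : pi (gl_mx (gassner g) last (w b)) = 0.
  exact: (pi_last_row (ge last b)).
have pi_rowE (f : 'I_m.+1 -> laurent m.+1) :
    pi (\sum_b gl_mx (gassner g) last b * f b) =
    pi (gl_mx (gassner g) last last) * pi (f last).
  rewrite rmorph_sum big_ord_recr /= big1 ?add0r ?rmorphM // => b _.
  by rewrite rmorphM /= pi_row mul0r.
rewrite gmulfM; split=> [a k||c].
- rewrite mxE; under eq_bigr => b _ do rewrite ge' mulrDr mulrCA.
  rewrite big_split -mulr_sumr mulrDr addrA; congr (_ + _).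
  rewrite (bigD1 (w k)) //= eqxx mulr1 big1 ?addr0 ?ge // => b /negbTE->.
  by rewrite mulr0.
- rewrite mxE pi_rowE !mpolyXD !tofracM -gt -gt'; ring.
have [D [DE Dg Dphi]] := gD (c + q')%MM.
have [D' [DE' Dg' Dphi']] := gD' (c + p)%MM.
have e1 : (c + (q + q') = c + q' + q)%MM by rewrite [(q + q')%MM]addmC addmA.
have e2 : (c + (p + p') = c + p + p')%MM by rewrite addmA.
have e3 : (c + q' + p = c + p + q')%MM by rewrite -!addmA [(q' + p)%MM]addmC.
exists (fun k => D k + D' k).
rewrite e1 e2 (@transportM _ (c + q' + p)%MM) {2 4}e3.
split=> [k||].
- rewrite tofracD DE DE' rmorphD /= pi_rowE mulrDr; congr (_ + _).
  by rewrite !mpolyXD !tofracM -gt; ring.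
- by rewrite -[X in transport X _ g']e3 in Dg' *; exact: (subgroupM G2s Dg Dg').
rewrite phiD // Dphi Dphi' -big_split; apply: eq_bigr => k _.
by rewrite raddfD.
Qed.

(** The path of the inverse is the path of [g] run backwards, from [p] to [q],
    and each edge is counted with the opposite sign. *)
Lemma fox_chainV g : fox_chain g -> fox_chain g^-1%g.
Proof.
move=> [gam [p [q [ge gt gD]]]].
have inv1 : gl_mx (gassner g^-1%g) *m gl_mx (gassner g) = 1%:M.
  have : gl_mx (gassner (g^-1 * g)%g) = 1%:M by rewrite mulVg gmulf1.
  by rewrite gmulfM.
set A := gl_mx (gassner g^-1%g) in inv1 *.
have AE a k : A a (w k) = (a == w k)%:R + h * (- \sum_b A a b * gam b k).
  move/matrixP/(_ a (w k)): inv1; rewrite !mxE => <-.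
  under eq_bigr => b _ do rewrite ge mulrDr mulrCA.
  rewrite big_split -mulr_sumr mulrN addrK.
  rewrite (bigD1 (w k)) //= eqxx mulr1 big1 ?addr0 // => b /negbTE->.
  by rewrite mulr0.
exists (fun a k => - \sum_b A a b * gam b k), q, p.
have pi_row b : pi (A last (w b)) = 0 by exact: (pi_last_row (AE last b)).
have pi_rowE (f : 'I_m.+1 -> laurent m.+1) :
    pi (\sum_b A last b * f b) = pi (A last last) * pi (f last).
  rewrite rmorph_sum big_ord_recr /= big1 ?add0r ?rmorphM // => b _.
  by rewrite rmorphM /= pi_row mul0r.
have piA : pi (A last last) * ('X_[p])%:F = ('X_[q])%:F.
  rewrite -gt mulrA -(pi_rowE (fun b => gl_mx (gassner g) b last)).
  move/matrixP/(_ last last): inv1; rewrite !mxE eqxx => ->.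
  by rewrite rmorph1 mul1r.
split=> // c; have [D [DE Dg Dphi]] := gD c.
exists (fun k => - D k); rewrite transportV; split=> [k||].
- rewrite tofracN DE rmorphN /= pi_rowE !mpolyXD !tofracM -piA; ring.
- exact: (subgroupV G2s).
rewrite (additive_onV G2s phiD) // Dphi -sumrN; apply: eq_bigr => k _.
by rewrite raddfN.
Qed.

Lemma last_string_fox_chain g : F g -> fox_chain g.
Proof.
rewrite last_string_generated; apply: generated_ind.
- exact: fox_chain1.
- by move=> x y _ _; exact: fox_chainM.
- by move=> x _; exact: fox_chainV.
- by move=> _ [i _ <-]; exact: fox_chain_gen.
Qed.

Lemma one_sub_last_var_reg x : h * x = 0 -> x = 0.
Proof.
have hE : laurent_val h = 1 - tofrac ('X_last : {mpoly int[m.+1]}).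
  by rewrite [LHS](rmorphB val) rmorph1.
move=> hx; have /eqP : laurent_val h * laurent_val x = 0.
  by rewrite -[LHS](rmorphM val) hx rmorph0.
rewrite mulf_eq0 hE.
case/orP => [|/eqP x0]; last by apply/val_inj; rewrite rmorph0.
rewrite -(tofrac1 {mpoly int[m.+1]}) -tofracB tofrac_eq0.
move=> /eqP/(congr1 (mcoeff 0%MM))/eqP; rewrite mcoeffB mcoeff1 mcoeffX mcoeff0.
rewrite eqxx; suff -> : (U_(last)%MM == 0%MM :> 'X_{1..m.+1}) = false by [].
by apply/eqP => /mnmP/(_ last); rewrite mnmE mnm0E eqxx.
Qed.

(** The chain of [g] is zero and its path is closed, by the last entry of the
    last row. *)
Lemma gassner_kernel_transport g : F g -> gassner g = 1%g ->
  exists q, G2 (transport q q g) /\ phi (transport q q g) = 0.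
Proof.
move=> /last_string_fox_chain[gam [p [q [ge gt gD]]]] g1; rewrite g1 in ge gt.
have gam0 k : gam last k = 0.
  have /eqP := ge last k; rewrite mxE -subr_eq0 opprD addNKr oppr_eq0 => /eqP.
  exact: one_sub_last_var_reg.
have pq : p = q.
  move: gt; rewrite mxE eqxx rmorph1 mul1r => /eqP; rewrite tofrac_eq => /eqP.
  move=> /(congr1 (mcoeff q))/eqP; rewrite !mcoeffX eqxx.
  by case: (p =P q).
have [D [DE Dg Dphi]] := gD 0%MM; subst p; exists (0 + q)%MM; split=> //.
rewrite Dphi big1 // => k _; suff -> : D k = 0 by exact: chain_value0.
by apply/eqP; rewrite -tofrac_eq0 DE gam0 rmorph0 mulr0.
Qed.

End Potential.

(** [phi] kills the conjugate of [g] by the element of a vertex of the path, and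
    [F''] is normalized by [F]. *)
Lemma gassner_kernel_second_derived g : F g -> gassner g = 1%g ->
  commutator_subgroup G2 G2 g.
Proof.
move=> Fg g1; have G2s := commutator_subgroupP F F.
have GG2 x y : G2 x -> G2 y -> commutator_subgroup G2 G2 [~ x, y]%g.
  exact: mem_commutator.
have [Z [phi [phiD [phi0 _]]]] :=
  abelian_quotient G2s (commutator_subgroupP G2 G2)
  (commutator_sub G2s (@subset_refl _ _) (@subset_refl _ _)) GG2.
have [q [Gt /(phi0 _ Gt) tg]] := gassner_kernel_transport phiD Fg g1.
have -> : g = (transport q q g ^ lift_elt q)%g.
  by rewrite conjgE /transport !mulgA mulVg mul1g mulgVK.
have nG := lower2_normalized (last_string_is_subgroup m).
exact: (commutator_normalized nG nG tg (lift_elt_in q)).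
Qed.

End FoxChain.

Theorem theorem3p4 (n : nat) (n_gt0 : (0 < n)%N) :
  subset (@ker_gassner_last n)
    (commutator_subgroup (lower_central 3 (@last_string_subgroup n))
                         (lower_central 2 (@last_string_subgroup n))).
Proof.
case: n n_gt0 => // m _ g [Fg g1]; set F := @last_string_subgroup m.+1.
have Fs : is_subgroup F := last_string_is_subgroup m.
have F2g := gassner_kernel_second_derived Fg g1.
have [Z [phi [phiD [phi0 phiK]]]] := abelian_quotient
  (commutator_subgroupP (commutator_subgroup F F) (commutator_subgroup F F))
  (commutator_subgroupP (commutator_subgroup (commutator_subgroup F F) F)
                        (commutator_subgroup F F))
  (lower32_sub Fs) (second_derived_commg Fs).
by apply: phi0 => //; apply: (second_derived_kernel_test F2g g1).
Qed.
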